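(* Let $\theta\in\Sigma\setminus\Sigma^0$. (i) If $K\subset\mathbb{C}^d$ is compact and regular, then $$\tau(K,\theta)=\lim_{\frac{\alpha}{|\alpha|}\to\theta}\tau_{K,\alpha},$$ i.e. the limsup defining $\tau(K,\theta)$ is a limit: $\tau_{K,\alpha(j)}\to\tau(K,\theta)$ for every sequence of multi-indices $\alpha(j)$ with $|\alpha(j)|\to\infty$ and $\alpha(j)/|\alpha(j)|\to\theta$. (ii) If $K\subset\mathbb{C}^d$ is compact and locally regular and $w\ge 0$ is a continuous, admissible weight function on $K$, then $$\tau^w(K,\theta)=\lim_{\frac{\alpha}{|\alpha|}\to\theta}\tau^w_{K,\alpha},$$ i.e. the limsup defining $\tau^w(K,\theta)$ is a limit, in the same sense.
   Context: Simplex: $\Sigma=\{(x_1,\dots,x_d)\in\mathbb{R}^d: 0\le x_i\le 1,\ \sum_i x_i=1\}$ and $\Sigma^0=\{(x_1,\dots,x_d)\in\mathbb{R}^d: 0<x_i<1,\ \sum_i x_i=1\}$. Multi-indices and order: for $\alpha\in\mathbb{Z}_{\ge0}^d$ put $|\alpha|=\alpha_1+\dots+\alpha_d$ and $z^\alpha=z_1^{\alpha_1}\cdots z_d^{\alpha_d}$. Multi-indices (equivalently monomials) are ordered by the graded lexicographic order $\prec$ with $z_1\prec z_2\prec\cdots\prec z_d$: $\alpha\prec\beta$ iff $|\alpha|<|\beta|$, or $|\alpha|=|\beta|$, $\alpha\neq\beta$ and at the smallest index $k$ with $\alpha_k\ne\beta_k$ one has $\alpha_k>\beta_k$ (so $z_1^n$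 is the first monomial of degree $n$). Let $M_\alpha=\{p\in\mathbb{C}[z_1,\dots,z_d]: p(z)=z^\alpha+\sum_{\beta\prec\alpha}c_\beta z^\beta\}$. Chebyshev constants: for $K\subset\mathbb{C}^d$ compact, $\|f\|_K=\max_K|f|$, and for $|\alpha|\geq 1$, $\tau_{K,\alpha}=\inf\{\|p\|_K:p\in M_\alpha\}^{1/|\alpha|}$. A weight $w\ge0$ on $K$ is admissible if $\{z\in K:w(z)>0\}$ is nonpluripolar; $\tau^w_{K,\alpha}=\inf\{\|w^{|\alpha|}p\|_K:p\in M_\alpha\}^{1/|\alpha|}$. For $\theta\in\Sigma$, $\tau(K,\theta):=\limsup_{\alpha/|\alpha|\to\theta}\tau_{K,\alpha}$ and $\tau^w(K,\theta):=\limsup_{\alpha/|\alpha|\to\theta}\tau^w_{K,\alpha}$; here and in limits, $\alpha/|\alpha|\to\theta$ is understood along multi-indices with $|\alpha|\to\infty$. Regularity: $L(\mathbb{C}^d)$ is the set of plurisubharmonic functions $u$ on $\mathbb{C}^d$ with $u(z)\le\log|z|+O(1)$ as $|z|\to\infty$. $V_K(z)=\sup\{u(z):u\in L(\mathbb{C}^d),\ u\le0\text{ on }K\}$ and $V_K^*(z)=\limsup_{\zeta\to z}V_K(\zeta)$. $K$ is regular if $V_K$ is continuous on $K$, i.e. $V_K=V_K^*$. $K$ is locally regular if for every $a\in K$ and $r>0$, $V^*_{K\cap B(a,r)}(a)=0$, where $B(a,r)=\{z:|z-a|\le r\}$. *)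

(* Defs.v *)
From HB Require Import structures.
From mathcomp Require Import all_boot all_order all_algebra.
From mathcomp Require Import complex.
From mathcomp Require Import all_classical all_reals all_analysis.
(* The notations of mpoly clash with those of MathComp-Analysis: [multinom d]
   and [mpoly d A] below are 'X_{1..d} and {mpoly A[d]}, and [mcoeff m p],
   [meval v p] are p@_m and p.@[v]. *)
From mathcomp Require Import -(notations) mpoly.

Set Implicit Arguments.
Unset Strict Implicit.
Unset Printing Implicit Defensive.

Import Order.TTheory GRing.Theory Num.Theory.
Import numFieldNormedType.Exports.

Local Open Scope classical_set_scope.
Local Open Scope ring_scope.

(* R[i] itself carries no topology in the libraries; its copy R[i]^o does. *)
Notation cspace R d := 'rV[(complex R)^o]_d.

Section simplex.
Context (R : realType) (d : nat).

Definition simplex : set 'rV[R]_d :=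
  [set x | (forall i, 0 <= x ord0 i <= 1) /\ \sum_i x ord0 i = 1].

Definition simplex0 : set 'rV[R]_d :=
  [set x | (forall i, 0 < x ord0 i < 1) /\ \sum_i x ord0 i = 1].

End simplex.

Arguments simplex R d : clear implicits.
Arguments simplex0 R d : clear implicits.

Section multi_indices.
Context (R : realType) (d : nat).
Implicit Types (a b : multinom d) (theta : 'rV[R]_d).

(* Not the library's order on multinomials: in equal degree, the multi-index
   with the LARGER first differing entry comes first. *)
Definition glex_lt a b : Prop :=
  (mdeg a < mdeg b)%N \/
  mdeg a = mdeg b /\
  exists k : 'I_d, (forall i : 'I_d, (i < k)%N -> a i = b i) /\ (b k < a k)%N.

Definition direction a : 'rV[R]_d := \row_i ((a i)%:R / (mdeg a)%:R).

Definition tends_to_direction (s : nat -> multinom d) theta : Prop :=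
  (mdeg (s j) @[j --> \oo] --> \oo) /\ (direction (s j) @[j --> \oo] --> theta).

Definition limsup_direction (f : multinom d -> \bar R) theta : \bar R :=
  ereal_inf [set ereal_sup
      (f @` [set a | (eN.2 <= mdeg a)%N /\ `|direction a - theta| < eN.1])
    | eN in [set eN : R * nat | 0 < eN.1]].

Definition is_limit_direction (f : multinom d -> R) theta (l : \bar R) : Prop :=
  forall s : nat -> multinom d, tends_to_direction s theta ->
    (f (s j))%:E @[j --> \oo] --> l.

End multi_indices.

Section pluripotential.
Context (R : realType) (d : nat).
Implicit Types (u : cspace R d -> \bar R) (K E : set (cspace R d)).

Definition cnorm (z : cspace R d) : R :=
  Num.sqrt (\sum_i Normc.normc (z ord0 i) ^+ 2).

Definition cball (a : cspace R d) (r : R) : set (cspace R d) :=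
  [set z | cnorm (z - a) <= r].

Definition expi (t : R) : R[i] := Complex (cos t) (sin t).

Definition upper_semicontinuous u : Prop :=
  lower_semicontinuous (fun z => (- u z)%E).

(* The average over a circle of a complex line makes sense in [-oo, +oo[ since
   u is bounded above there. *)
Definition plurisubharmonic u : Prop :=
  [/\ (forall z, u z < +oo)%E,
      (exists z, u z != -oo%E),
      upper_semicontinuous u &
      forall a b : cspace R d,
        (u a <= ((2 * pi)^-1)%:E *
          \int[lebesgue_measure]_(t in `[0%R, (2 * pi)%R]) u (a + expi t *: b)%R)%E].

Definition pluripolar E : Prop :=
  exists2 u, plurisubharmonic u & forall z, E z -> u z = -oo%E.

Definition lelong_class : set (cspace R d -> \bar R) :=
  [set u | plurisubharmonic u /\
     exists r M : R, forall z, r <= cnorm z -> (u z <= (ln (cnorm z) + M)%:E)%E].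

Definition extremal K (z : cspace R d) : \bar R :=
  ereal_sup [set u z |
    u in lelong_class `&` [set u | forall x, K x -> (u x <= 0)%E]].

Definition extremal_reg K (z : cspace R d) : \bar R :=
  limf_esup (extremal K) (nbhs z).

(* Continuity at the points of K of V_K as a function on the whole space. *)
Definition regular K : Prop :=
  forall z, K z -> {for z, continuous (extremal K)}.

Definition locally_regular K : Prop :=
  forall a, K a -> forall r : R, 0 < r -> extremal_reg (K `&` cball a r) a = 0%E.

Definition admissible_weight K (w : cspace R d -> R) : Prop :=
  (forall z, K z -> 0 <= w z) /\ ~ pluripolar (K `&` [set z | 0 < w z]).

End pluripotential.

Section chebyshev_constants.
Context (R : realType) (d : nat).
Implicit Types (K : set (cspace R d)) (w : cspace R d -> R).
Implicit Types (a : multinom d) (theta : 'rV[R]_d).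

Definition monic_class a : set (mpoly d R[i]) :=
  [set p | mcoeff a p = 1 /\ forall b, b \in msupp p -> b = a \/ glex_lt b a].

Definition peval (p : mpoly d R[i]) (z : cspace R d) : R[i] :=
  meval (fun i => z ord0 i) p.

Definition sup_norm K (f : cspace R d -> R[i]) : R :=
  sup [set Normc.normc (f z) | z in K].

Definition cheb_const K a : R :=
  inf [set sup_norm K (peval p) | p in monic_class a] `^ ((mdeg a)%:R^-1).

Definition wcheb_const K w a : R :=
  inf [set sup_norm K (fun z => (real_complex R (w z)) ^+ mdeg a * peval p z)
      | p in monic_class a] `^ ((mdeg a)%:R^-1).

Definition dir_cheb_const K theta : \bar R :=
  limsup_direction (fun a => (cheb_const K a)%:E) theta.

Definition dir_wcheb_const K w theta : \bar R :=
  limsup_direction (fun a => (wcheb_const K w a)%:E) theta.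

End chebyshev_constants.

(* Main.v *)
(** Let Y a be the infimum of the weighted sup norms over the class of the
    multi-index a. It is submultiplicative and at most exponential in |a|.
    Differentiating a polynomial with leading exponent b + c by D^c gives one
    with leading exponent b, because the order is translation invariant; so
    Y b <= exp (e |b + c|) D^|c| Y (b + c) for every e > 0, as soon as the norm
    of a polynomial of degree n on K controls it on a neighbourhood of K up to
    a factor exp (e n). Regularity of K provides this through the Bernstein-Walsh
    inequality; in the weighted case local regularity does so near the points
    where w is not small, and elsewhere a crude growth bound is enough.
    Given the two estimates, let b be close in direction to theta, drop from b
    the entries outside the support of theta (they have total degree o(|b|)), and
    divide any later a close to theta by the result: a = r + q b' with r small.
    Hence the upper limit is at most the lower limit. *)

Require Import Defs.
From HB Require Import structures.
From mathcomp Require Import all_boot all_order all_algebra.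
From mathcomp Require Import complex.
From mathcomp Require Import all_classical all_reals all_analysis.
From mathcomp Require Import measurable_realfun.
From mathcomp Require Import -(notations) mpoly.
From mathcomp Require Import ring lra zify.
Set Implicit Arguments.
Unset Strict Implicit.
Unset Printing Implicit Defensive.
Import Order.TTheory GRing.Theory Num.Theory.
Import numFieldNormedType.Exports.
Local Open Scope classical_set_scope.
Local Open Scope ring_scope.

(** * Submultiplicative functions of a multi-index *)

(** Supplies a common lower bound for the positive coordinates of a direction; starting the minimum
    at 1 covers the case where there are none. *)
Lemma exists_min_pos (R : realFieldType) (d : nat) (x : 'I_d -> R) :
  exists2 m : R, 0 < m <= 1 & forall i, 0 < x i -> m <= x i.
Proof.
exists (\big[Num.min/1]_(i < d | 0 < x i) x i).
  by rewrite bigmin_le_id andbT; apply/bigmin_gtP.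
by move=> i hi; exact: bigmin_le_cond.
Qed.

Lemma le_coord_mx_norm (R : realType) (d : nat) (x : 'rV[R]_d) i :
  `|x ord0 i| <= `|x|.
Proof.
rewrite [leRHS]mx_normrE.
exact: (le_bigmax _ (fun ij => `|x ij.1 ij.2|) (ord0, i)).
Qed.

Section directions.
Context (R : realType) (d : nat).
Implicit Types (a b c : multinom d) (theta : 'rV[R]_d).

Lemma direction_coord a theta (dl : R) : (0 < mdeg a)%N ->
  `|direction R a - theta| < dl -> forall i,
  (mdeg a)%:R * (theta ord0 i - dl) <= (a i)%:R <=
  (mdeg a)%:R * (theta ord0 i + dl).
Proof.
move=> a0 had i; have A0 : 0 < (mdeg a)%:R :> R by rewrite ltr0n.
have h : `|(a i)%:R / (mdeg a)%:R - theta ord0 i| <= dl.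
  apply: le_trans (ltW had).
  have := le_coord_mx_norm (direction R a - theta) i.
  by rewrite !mxE.
move: h; rewrite ler_norml => /andP[h1 h2].
have e : (a i)%:R = (mdeg a)%:R * ((a i)%:R / (mdeg a)%:R) :> R.
  by rewrite mulrCA divff ?mulr1 // gt_eqF.
rewrite e !ler_pM2l //; apply/andP; split; lra.
Qed.

(** * Approximate division of multi-indices with close directions *)

Section approximate_division.
Context (theta : 'rV[R]_d) (m k : R).
Hypotheses (m01 : 0 < m <= 1) (k01 : 0 < k <= 1).
Hypothesis mmin : forall i, 0 < theta ord0 i -> m <= theta ord0 i.
Hypothesis theta0 : forall i, 0 <= theta ord0 i.

(** Chosen so that [(1 - k) * (t + dl) <= t - dl] for every coordinate [t >= m] of [theta]. *)
Let dl := k * m / 2.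

Lemma dl_le : 0 < dl <= k.
Proof.
have [m0 m1] := andP m01; have [k0 k1] := andP k01.
by rewrite /dl; apply/andP; split; nra.
Qed.

(** Where [theta] vanishes, an entry of [b] is at most [dl * mdeg b], hence at most [k * mdeg b];
    [c] collects these entries. *)
Lemma support_split b : (0 < mdeg b)%N -> `|direction R b - theta| < dl ->
  exists b' c, [/\ b = mnm_add b' c,
   forall i, theta ord0 i = 0 -> b' i = 0%N, forall i, (b' i <= b i)%N &
   (mdeg c)%:R <= d%:R * k * (mdeg b)%:R :> R].
Proof.
move=> b0 hb; pose P i := 0 < theta ord0 i.
exists (Multinom (mktuple (fun i => if P i then b i else 0%N))).
exists (Multinom (mktuple (fun i => if P i then 0%N else b i))); split.
- by apply/mnmP => i; rewrite mnmDE !mnmE; case: ifP; rewrite ?addn0 ?add0n.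
- by move=> i e; rewrite mnmE /P e ltxx.
- by move=> i; rewrite mnmE; case: ifP.
rewrite mdegE natr_sum.
apply: (@le_trans _ _ (\sum_(i < d) k * (mdeg b)%:R)); last first.
  by rewrite sumr_const card_ord -mulrA mulr_natl.
apply: ler_sum => i _; rewrite mnmE; case: ifPn => [_|].
  by apply: mulr_ge0; last exact: ler0n; case/andP: k01 => /ltW.
rewrite /P -leNgt => h; have /andP[_] := direction_coord b0 hb i.
move/le_trans; apply; rewrite mulrC; apply: ler_wpM2r => //.
have /andP[_ dk] := dl_le; lra.
Qed.

(** With [q] about [(1 - k) |a| / |b|], an entry of [q b'] on the support of [theta] is at most
    [|a| (1 - k) (theta_i + dl)], which the choice of [dl] keeps below the entry of [a]. Off the
    support [b'] is zero. *)
Lemma approx_division b b' : (0 < mdeg b)%N ->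
  `|direction R b - theta| < dl ->
  (forall i, theta ord0 i = 0 -> b' i = 0%N) ->
  (forall i, (b' i <= b i)%N) ->
  exists N, forall a, (N <= mdeg a)%N -> `|direction R a - theta| < dl ->
    exists q r, [/\ a = mnm_add r (mnm_muln b' q), (0 < mdeg a)%N,
      (1 - 2 * k) * (mdeg a)%:R <= q%:R * (mdeg b)%:R :> R &
      q%:R * (mdeg b)%:R <= (mdeg a)%:R :> R].
Proof.
move=> b0 hb b'0 b'b; have B0 : 0 < (mdeg b)%:R :> R by rewrite ltr0n.
have [k0 k1] := andP k01.
(* Beyond this degree [mdeg b <= k * mdeg a], so truncating the quotient loses at most a second
   share [k] of the degree of [a]. *)
exists (Num.truncn ((mdeg b)%:R / k)).+1 => a aN ha.
have a0 : (0 < mdeg a)%N by apply: leq_trans aN.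
have A0 : 0 < (mdeg a)%:R :> R by rewrite ltr0n.
have kA : (mdeg b)%:R <= k * (mdeg a)%:R.
  rewrite mulrC -ler_pdivrMr //; apply/ltW/(lt_le_trans (Num.Theory.truncnS_gt _)).
  by rewrite ler_nat.
pose x := (mdeg a)%:R * (1 - k) / (mdeg b)%:R.
have x0 : 0 <= x by rewrite /x divr_ge0 ?mulr_ge0 ?subr_ge0.
pose q := Num.truncn x.
have qx : q%:R * (mdeg b)%:R <= (mdeg a)%:R * (1 - k).
  by rewrite -ler_pdivlMr // truncn_le.
have xq : (mdeg a)%:R * (1 - k) <= (q%:R + 1) * (mdeg b)%:R.
  by rewrite -ler_pdivrMr // natr1 ltW // truncnS_gt.
have le_qa i : (b' i * q <= a i)%N.
  have [/eqP e|th] := boolP (theta ord0 i == 0); first by rewrite b'0.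
  have {}th : 0 < theta ord0 i by rewrite lt_def th theta0.
  have := mmin th.
  have /andP[ha1 _] := direction_coord a0 ha i.
  have /andP[_ hb2] := direction_coord b0 hb i.
  move=> mth; rewrite -(ler_nat R) natrM; apply: le_trans ha1.
  have b'R : (b' i)%:R <= (b i)%:R :> R by rewrite ler_nat.
  apply: (@le_trans _ _ ((mdeg b)%:R * (theta ord0 i + dl) * q%:R)).
    by rewrite ler_wpM2r //; apply: le_trans hb2.
  rewrite mulrC mulrA.
  apply: (@le_trans _ _ ((mdeg a)%:R * (1 - k) * (theta ord0 i + dl))).
    by rewrite ler_wpM2r // addr_ge0 //; case/andP: dl_le => /ltW.
  rewrite -mulrA ler_pM2l //; rewrite /dl.
  have h1 : k * m <= k * theta ord0 i by rewrite ler_pM2l.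
  have m0 : 0 < m by case/andP: m01.
  have h2 : 0 <= k * (k * m) by rewrite !mulr_ge0 // ltW.
  lra.
exists q, (mnm_sub a (mnm_muln b' q)); split => //.
- by rewrite submK //; apply/mnm_lepP => i; rewrite mulmnE.
- nra.
- by apply: (le_trans qx); nra.
Qed.

End approximate_division.

(** * Limits of the root rates of a submultiplicative function *)

Section submultiplicative.
Context (Y : multinom d -> R) (g0 : R) (theta : 'rV[R]_d).
Hypothesis Y0 : forall a, 0 <= Y a.
Hypothesis YM : forall a b, Y (mnm_add a b) <= Y a * Y b.
Hypothesis Yle : forall a, Y a <= expR (g0 * (mdeg a)%:R).
Hypothesis Yge : forall e : R, 0 < e -> exists2 g : R, 0 <= g & forall b c,
  (0 < mdeg (mnm_add b c))%N ->
  Y b <= expR (e * (mdeg (mnm_add b c))%:R + g * (mdeg c)%:R) * Y (mnm_add b c).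
Hypothesis theta_simplex : simplex R d theta.

Lemma submul_muln b q : Y (mnm_muln b q) <= Y b ^+ q.
Proof.
elim: q => [|q IH].
  rewrite mulm0n expr0; have := Yle (mnm0 : multinom d).
  by rewrite mdeg0 mulr0 expR0.
rewrite mulmS exprS; apply: le_trans (YM _ _) _.
by rewrite ler_wpM2l.
Qed.

(** One index [b] controls all later ones: with [a = r + q b'], submultiplicativity gives
    [Y a <= Y r * Y b' ^ q], and [Yge] bounds [Y b'] by [Y b]. One [e] is the loss in [Yge], the
    other pays for the degrees of [c] and [r], which are small with [k]. *)
Lemma submul_close_directions (l e : R) : 0 < e ->
  exists2 dl, 0 < dl & forall b, (0 < mdeg b)%N ->
    `|direction R b - theta| < dl -> Y b <= expR (l * (mdeg b)%:R) ->
  exists N, forall a, (N <= mdeg a)%N -> `|direction R a - theta| < dl ->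
    Y a <= expR ((l + 2 * e) * (mdeg a)%:R).
Proof.
move=> e0; have [g g_ge0 hg] := Yge e0.
have [m m01 mmin] := exists_min_pos (theta ord0).
have theta0 i : 0 <= theta ord0 i by have [h _] := theta_simplex; have /andP[] := h i.
pose D := d%:R : R; have D0 : 0 <= D by [].
(* [W] sums the coefficients of [k * A] in the final exponent: [g * D] from [c], [2 * |l|] from
   replacing [q B] by [A], [|g0| * (2 + D)] from [r]; the 1 makes it positive. *)
pose W := g * D + 2 * `|l| + `|g0| * (2 + D) + 1.
have W0 : 0 < W.
  by rewrite ltr_wpDl // !addr_ge0 // mulr_ge0 // addr_ge0.
pose k := Num.min 1 (e / W).
have k01 : 0 < k <= 1.
  by rewrite /k lt_min ltr01 divr_gt0 //= ge_min lexx.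
have kW : k * W <= e by rewrite -ler_pdivlMr // /k ge_min lexx orbT.
exists (k * m / 2); first by case/andP: (dl_le m01 k01).
move=> b b0 hb Yb.
have [b' [c [bE b'0 b'b cb]]] := support_split m01 k01 b0 hb.
have [N hN] := approx_division m01 k01 mmin theta0 b0 hb b'0 b'b.
exists N => a aN ha; have [q [r [aE a0 q1 q2]]] := hN a aN ha.
have dB : (mdeg b)%:R = (mdeg b')%:R + (mdeg c)%:R :> R.
  by rewrite bE mdegD natrD.
have dA : (mdeg a)%:R = (mdeg r)%:R + q%:R * (mdeg b')%:R :> R.
  by rewrite aE mdegD mdegMn natrD natrM [in RHS]mulrC.
set A : R := (mdeg a)%:R in aN a0 q1 q2 dA *; set B : R := (mdeg b)%:R in Yb cb q1 q2 dB.
have A0 : 0 <= A by rewrite /A.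
have Yb' : Y b' <= expR (e * B + g * (mdeg c)%:R + l * B).
  rewrite expRD; have := hg b' c; rewrite -bE => /(_ b0) /le_trans; apply.
  by rewrite ler_wpM2l.
rewrite aE; apply: le_trans (YM _ _) _.
apply: (@le_trans _ _ (expR (`|g0| * (mdeg r)%:R +
    q%:R * (e * B + g * (mdeg c)%:R + l * B)))).
  rewrite expRD; apply: ler_pM => //.
    apply: le_trans (Yle _) _; rewrite ler_expR ler_wpM2r //; exact: ler_norm.
  apply: le_trans (submul_muln _ _) _.
  by rewrite mulrC expRM_natr lerXn2r ?nnegrE ?expR_ge0.
rewrite ler_expR; set X := q%:R * B in q1 q2.
set s := (mdeg c)%:R in cb dB *; rewrite -/D in cb.
have q0 : 0 <= q%:R :> R by [].
have [k0 _] := andP k01.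
have qs : q%:R * s <= D * k * A.
  apply: (@le_trans _ _ (D * k * X)).
    by rewrite /X mulrCA ler_wpM2l.
  by rewrite ler_wpM2l // mulr_ge0 // ltW.
have rho : (mdeg r)%:R <= (2 + D) * k * A.
  have -> : (mdeg r)%:R = A - X + q%:R * s :> R by rewrite /X dB dA; ring.
  lra.
have l1 : l * X <= l * A + `|l| * (2 * k * A).
  have : `|l| * (A - X) <= `|l| * (2 * k * A) by rewrite ler_wpM2l //; lra.
  have : - `|l| * (A - X) <= l * (A - X).
    by rewrite ler_wpM2r ?subr_ge0 // lerNl -normrN ler_norm.
  lra.
have g1 : g * (q%:R * s) <= g * (D * k * A) by rewrite ler_wpM2l.
have g2 : `|g0| * (mdeg r)%:R <= `|g0| * ((2 + D) * k * A) by rewrite ler_wpM2l.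
have e1 : e * X <= e * A by rewrite ler_wpM2l // ltW.
have kA : k * W * A <= e * A by rewrite ler_wpM2r.
have kA0 : 0 <= k * A by rewrite mulr_ge0 // ltW.
apply: (@le_trans _ _ (e * X + g * (q%:R * s) + l * X + `|g0| * (mdeg r)%:R)).
  by rewrite le_eqVlt /X; apply/orP; left; apply/eqP; ring.
move: kA; rewrite /W; lra.
Qed.

Definition root_rate a : R := Y a `^ ((mdeg a)%:R^-1).

Lemma root_rate_ge0 a : 0 <= root_rate a. Proof. exact: powR_ge0. Qed.

Lemma root_rate_le a l : (0 < mdeg a)%N ->
  (root_rate a <= expR l) = (Y a <= expR (l * (mdeg a)%:R)).
Proof.
move=> a0; have A0 : (mdeg a)%:R != 0 :> R by rewrite pnatr_eq0 -lt0n.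
have Ai : 0 <= (mdeg a)%:R^-1 :> R by rewrite invr_ge0.
apply/idP/idP => h.
  have := @ge0_ler_powR R (mdeg a)%:R (ler0n _ _) _ _ (powR_ge0 _ _) (expR_ge0 l) h.
  by rewrite -powRrM mulVf // powRr1 // -expRM.
have := @ge0_ler_powR R _ Ai _ _ (Y0 a) (expR_ge0 _) h.
by rewrite -expRM mulfK.
Qed.

Lemma limsup_direction_le (f : multinom d -> \bar R) (e : R) N x : 0 < e ->
  (forall a, (N <= mdeg a)%N -> `|direction R a - theta| < e -> (f a <= x)%E) ->
  (limsup_direction f theta <= x)%E.
Proof.
move=> e0 h; pose S := [set a | (N <= mdeg a)%N /\ `|direction R a - theta| < e].
apply: (@le_trans _ _ (ereal_sup (f @` S))).
  by apply: ereal_inf_lbound; exists (e, N).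
by apply: ge_ereal_sup => _ [a [aN ae] <-]; exact: h.
Qed.

Lemma tends_to_direction_near (s : nat -> multinom d) (e : R) N : 0 < e ->
  tends_to_direction s theta -> \forall j \near \oo,
  (N <= mdeg (s j))%N /\ `|direction R (s j) - theta| < e.
Proof.
move=> e0 [sdeg sdir]; near=> j; split; near: j.
  by move/cvgnyPge : sdeg => /(_ N).
by move/cvgrPdist_lt : sdir => /(_ e e0); apply: filterS => j; rewrite distrC.
Unshelve. all: by end_near. Qed.

(** The upper bound is the definition of the upper limit. For the lower one, a single index near
    [theta] with too small a rate would keep all later rates small and so push the upper limit below
    itself. *)
Lemma root_rate_limit :
  is_limit_direction root_rate theta
    (limsup_direction (fun a => (root_rate a)%:E) theta).
Proof.
move=> s hs; set L := limsup_direction _ _.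
have sN (e : R) N (P : nat -> Prop) : 0 < e ->
    (forall j, (N <= mdeg (s j))%N -> `|direction R (s j) - theta| < e -> P j) ->
    \forall j \near \oo, P j.
  move=> e0 h; have := tends_to_direction_near N e0 hs.
  by apply: filterS => j [? ?]; exact: h.
have Lup (c : R) : (L < c%:E)%E -> \forall j \near \oo, root_rate (s j) < c.
  move=> /ereal_inf_lt[_ [[e N] /= e0 <-]] Lc; apply: (sN e N) => // j jN je.
  rewrite -lte_fin; apply: le_lt_trans Lc; apply: ereal_sup_ubound.
  by exists (s j).
have Lge0 : (0%:E <= L)%E.
  apply: le_ereal_inf_tmp => _ [[e N] /= e0 <-].
  have [j _ hj] := tends_to_direction_near N e0 hs.
  apply: (@le_trans _ _ (root_rate (s j))%:E).
    by rewrite lee_fin root_rate_ge0.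
  by apply: ereal_sup_ubound; exists (s j) => //; exact: (hj j (leqnn j)).
have Lle : (L <= (expR g0)%:E)%E.
  apply: (@limsup_direction_le _ 1 1%N) => // a a0 _.
  by rewrite lee_fin root_rate_le // Yle.
have Lfin : L \is a fin_num.
  by rewrite ge0_fin_numE //; apply: le_lt_trans Lle _; exact: ltry.
rewrite -(fineK Lfin); set l := fine L.
have LE : L = l%:E by rewrite fineK.
apply: cvg_EFin; first by near=> j.
apply/cvgrPdist_lt => e e0.
(* For [l < e] nonnegativity of the rates already gives the lower bound; otherwise logarithms are
   available. *)
have [le0|le0] := ltP (l - e) 0.
  have : (L < (l + e)%:E)%E by rewrite LE lte_fin ltrDl.
  move=> /Lup; apply: filterS => j jl /=.
  have := root_rate_ge0 (s j); rewrite ltr_norml => ?; apply/andP; split; lra.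
pose c := l - e / 2; have c0 : 0 < c by rewrite /c; lra.
have l0 : 0 < l by lra.
have cl : ln c < ln l by rewrite ltr_ln ?posrE // /c; lra.
(* A quarter of the gap, so that [ln c + 2 * e'] is the midpoint, still below [ln l]. *)
pose e' := (ln l - ln c) / 4; have e'0 : 0 < e' by rewrite /e'; lra.
have [dl dl0 hdl] := submul_close_directions (ln c) e'0.
have low : \forall j \near \oo, c < root_rate (s j).
  apply: (sN dl 1%N) => // j j1 jdl; rewrite ltNge; apply/negP.
  rewrite -[c]lnK ?posrE // root_rate_le // => /(hdl _ j1 jdl)[N hN].
  have : (L <= (expR (ln c + 2 * e'))%:E)%E.
    apply: (@limsup_direction_le _ dl (maxn 1 N)) => // a.
    by rewrite geq_max => /andP[a1 aN] adl; rewrite lee_fin root_rate_le // hN.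
  rewrite LE lee_fin leNgt => /negP; apply.
  by rewrite -[ltRHS](@lnK _ l) ?posrE // ltr_expR /e'; lra.
have : (L < (l + e)%:E)%E by rewrite LE lte_fin ltrDl.
move=> /Lup; apply: filterS2 low => j; rewrite /c => jl ju /=.
by rewrite ltr_norml; apply/andP; split; lra.
Unshelve. all: by end_near. Qed.

End submultiplicative.
End directions.

(** * Averages over roots of unity *)

Section complex_modulus.
Context (R : realType).
Implicit Types (x y z : R[i]) (s t : R).
Local Notation normc := Normc.normc.
Local Notation expi := (@expi R).

Lemma normc_ge0 x : 0 <= normc x.
Proof. by case: x => a b; exact: sqrtr_ge0. Qed.

Lemma normcX x n : normc (x ^+ n) = normc x ^+ n.
Proof.
elim: n => [|n IH]; first by rewrite !expr0 Normc.normc1.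
by rewrite !exprS Normc.normcM IH.
Qed.

Lemma normc_real (r : R) : normc (real_complex R r) = `|r|.
Proof. by rewrite /= expr0n /= addr0 sqrtr_sqr. Qed.

Lemma normc_nat n : normc (n%:R : R[i]) = n%:R.
Proof. by rewrite normcMn Normc.normc1. Qed.

Lemma normc_prod (I : Type) (r : seq I) (P : pred I) (F : I -> R[i]) :
  normc (\prod_(i <- r | P i) F i) = \prod_(i <- r | P i) normc (F i).
Proof.
elim/big_ind2 : _ => [|x1 x2 y1 y2 h1 h2|//]; first by rewrite Normc.normc1.
by rewrite Normc.normcM h1 h2.
Qed.

Lemma le_normc_sum (I : Type) (r : seq I) (P : pred I) (F : I -> R[i]) :
  normc (\sum_(i <- r | P i) F i) <= \sum_(i <- r | P i) normc (F i).
Proof.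
elim/big_ind2 : _ => [|x1 x2 y1 y2 h1 h2|//]; first by rewrite Normc.normc0.
exact: le_trans (le_normcD _ _) (lerD h1 h2).
Qed.

Lemma ler_dist_normc x y : `|normc x - normc y| <= normc (x - y).
Proof.
have h u v : normc u - normc v <= normc (u - v).
  by rewrite lerBlDr; have := le_normcD (u - v) v; rewrite subrK.
rewrite ler_norml h andbT lerNl opprB.
by rewrite -[leRHS]normcN opprB h.
Qed.

Lemma normc_pair (a b : R) : normc (Complex a b) <= `|a| + `|b|.
Proof.
rewrite /= -[leRHS]ger0_norm ?addr_ge0 // -sqrtr_sqr ler_wsqrtr //.
rewrite sqrrD !real_normK ?num_real // lerD2r lerDl.
by rewrite mulrn_wge0 // mulr_ge0.
Qed.

Lemma expiD s t : expi (s + t) = expi s * expi t.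
Proof.
rewrite /Defs.expi sinD cosD; apply/eqP; rewrite eq_complex /=.
by rewrite eqxx /= addrC.
Qed.

Lemma expi0 : expi 0 = 1.
Proof. by rewrite /Defs.expi cos0 sin0. Qed.

Lemma expiX t n : expi t ^+ n = expi (t *+ n).
Proof.
by elim: n => [|n IH]; rewrite ?expr0 ?mulr0n ?expi0 // exprS mulrS expiD IH.
Qed.

Lemma normc_expi t : normc (expi t) = 1.
Proof. by rewrite /= cos2Dsin2 sqrtr1. Qed.

Lemma expi2pi : expi (2 * pi) = 1.
Proof. by rewrite mulr_natl /Defs.expi cos2pi mulr2n sinDpi sinpi oppr0. Qed.

Lemma lipschitz1_of_derive (f df : R -> R) :
  (forall u : R, is_derive u 1 f (df u)) -> (forall u : R, `|df u| <= 1) ->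
  forall s t, `|f s - f t| <= `|s - t|.
Proof.
move=> fd df1; suff h (s t : R) : s <= t -> `|f s - f t| <= `|s - t|.
  by move=> s t; case: (leP s t) => [|/ltW] /h //; rewrite distrC (distrC t).
move=> st; have [] := @MVT_segment R f df s t st (fun u _ => fd u).
  apply: derivable_within_continuous => x _; exact: ex_derive.
move=> c _; rewrite distrC (distrC s) => ->; rewrite normrM.
by apply: ler_piMl.
Qed.

Lemma expi_lipschitz s t : normc (expi s - expi t) <= 2 * `|s - t|.
Proof.
apply: le_trans (normc_pair _ _) _; rewrite mulr_natl mulr2n; apply: lerD.
  apply: (@lipschitz1_of_derive cos (fun u : R => - sin u)) => u.
  by rewrite normrN sin_max.
by apply: (@lipschitz1_of_derive sin cos) => x; exact: cos_max.
Qed.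

Lemma cos_neq1 t : 0 < t < 2 * pi -> cos t != 1.
Proof.
have h u : 0 < u <= pi -> cos u < 1.
  move=> /andP[u0 up]; have : cos u < cos 0.
    by rewrite ltr_cos // in_itv /= ?lexx ?pi_ge0 // ltW.
  by rewrite cos0.
move=> /andP[t0 tp]; have [tpi|pit] := leP t pi.
  by rewrite lt_eqF // h // t0.
rewrite -cosN -(cosD2pi (- t)) lt_eqF // h //; apply/andP; split.
  by rewrite addrC subr_gt0 -(mulr_natl pi 2).
by rewrite -(mulr_natl pi 2) addrC; lra.
Qed.

Definition unit_root (N : nat) : R[i] := expi (2 * pi / N%:R).

Lemma unit_rootX N j : unit_root N ^+ j = expi (2 * pi * j%:R / N%:R).
Proof. by rewrite expiX -(mulr_natr (2 * pi / N%:R) j) mulrAC. Qed.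

Lemma unit_root_prim N : (0 < N)%N -> N.-primitive_root (unit_root N).
Proof.
move=> N0; have NR : 0 < N%:R :> R by rewrite ltr0n.
rewrite /primitive_root_of_unity N0; apply/forallP => /= i.
rewrite unity_rootE unit_rootX; have [e|ne] := eqVneq i.+1 N.
  by rewrite e mulfK ?expi2pi ?eqxx // gt_eqF.
apply/eqP/negbTE; apply/eqP => h.
have iN : (i.+1 < N)%N by rewrite ltn_neqAle ne ltn_ord.
have : cos (2 * pi * i.+1%:R / N%:R) != 1 :> R.
  apply: cos_neq1; apply/andP; split.
    by rewrite divr_gt0 // mulr_gt0 // mulr_gt0 // pi_gt0.
  by rewrite ltr_pdivrMr // ltr_pM2l ?ltr_nat // mulr_gt0 // pi_gt0.
by case: h => ->; rewrite eqxx.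
Qed.

Lemma sum_unit_root N m : (0 < N)%N ->
  \sum_(j < N) (unit_root N ^+ m) ^+ j = ((N %| m)%N * N)%:R.
Proof.
move=> N0; have pr := unit_root_prim N0.
have [Nm|Nm] := boolP (N %| m)%N.
  rewrite (eq_bigr (fun=> 1)); first by rewrite sumr_const card_ord mul1n.
  move=> j _; have /eqP -> : unit_root N ^+ m == 1 by rewrite -(prim_order_dvd pr).
  by rewrite expr1n.
apply/eqP; rewrite mul0n; have := subrX1 (unit_root N ^+ m) N.
rewrite -exprM mulnC exprM (prim_expr_order pr) expr1n subrr => /esym/eqP.
by rewrite mulf_eq0 subr_eq0 -(prim_order_dvd pr) (negbTE Nm).
Qed.

(** Discrete Fourier inversion: [N - k] stands for [-k] modulo [N], and [size q <= N] rules out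
    aliasing. *)
Lemma coef_average (q : {poly R[i]}) N k (rho : R[i]) :
  (size q <= N)%N -> (k < N)%N ->
  \sum_(j < N) unit_root N ^+ ((N - k) * j) * q.[rho * unit_root N ^+ j] =
  N%:R * (q`_k * rho ^+ k).
Proof.
move=> qN kN; have N0 : (0 < N)%N by apply: leq_trans kN.
transitivity (\sum_(j < N) \sum_(i < N)
    q`_i * rho ^+ i * (unit_root N ^+ (N - k + i)) ^+ j).
  apply: eq_bigr => j _; rewrite (horner_coef_wide _ qN) mulr_sumr.
  apply: eq_bigr => i _; rewrite exprMn -!exprM mulnDl exprD (mulnC j i).
  by rewrite mulrCA !mulrA; congr (_ * _); rewrite mulrAC.
rewrite exchange_big /= (bigD1 (Ordinal kN)) //= -mulr_sumr sum_unit_root //.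
rewrite subnK 1?ltnW // dvdnn mul1n mulrC big1 ?addr0 //.
move=> i ik; rewrite -mulr_sumr sum_unit_root // [(_ %| _)%N](_ : _ = false) ?mulr0 //.
apply/negbTE; apply: contra ik => /dvdnP[c hc]; apply/eqP/val_inj => /=.
(* [N - k + i] lies strictly between 0 and [2 N], so it is a multiple of [N] only for [i = k]. *)
have iN := ltn_ord i; case: c hc => [|[|c]] hc; move: hc; rewrite ?mulSn; lia.
Qed.

(** The coefficient is a finite average of values on the circle of radius [rho], with weights of
    modulus 1. *)
Lemma cauchy_coef (q : {poly R[i]}) (rho B : R) k : 0 <= rho ->
  (forall t, 0 <= t -> normc q.[real_complex R rho * expi t] <= B) ->
  normc q`_k * rho ^+ k <= B.
Proof.
move=> rho0 hB; pose N := maxn (size q) k.+1.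
have qN : (size q <= N)%N by rewrite leq_maxl.
have kN : (k < N)%N by rewrite leq_maxr.
have N0 : (0 < N)%N by apply: leq_trans kN.
have := coef_average (real_complex R rho) qN kN.
move=> /(congr1 (fun z => normc z)); rewrite !Normc.normcM normcX normc_nat normc_real.
rewrite ger0_norm // => h.
rewrite -(@ler_pM2l _ N%:R) ?ltr0n // -h.
apply: le_trans (le_normc_sum _ _ _) _.
rewrite mulr_natl -[X in _ *+ X]card_ord -sumr_const.
apply: ler_sum => j _; rewrite Normc.normcM !normcX normc_expi expr1n mul1r unit_rootX.
by apply: hB; rewrite divr_ge0 // mulr_ge0 // mulr_ge0 // pi_ge0.
Qed.

(** The value at 0 is the mean of the values at [N]-th roots of unity, which therefore cannot all be
    strictly smaller in modulus. *)
Lemma max_principle (q : {poly R[i]}) :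
  exists2 t, 0 <= t & normc q.[0] <= normc q.[expi t].
Proof.
apply: contrapT => h.
pose N := maxn (size q) 1.
have N0 : (0 < N)%N by rewrite leq_max orbT.
have := @coef_average q N 0 1 (leq_maxl _ _) N0.
rewrite expr0 mulr1 -horner_coef0 => /(congr1 (fun z => normc z)).
rewrite Normc.normcM normc_nat => e.
suff : N%:R * normc q.[0] < N%:R * normc q.[0] by rewrite ltxx.
rewrite -{1}e; apply: le_lt_trans (le_normc_sum _ _ _) _.
rewrite mulr_natl -[X in _ *+ X]card_ord -sumr_const.
apply: ltr_sum => [|j _].
  by apply/hasP; exists (Ordinal N0); rewrite ?mem_index_enum.
rewrite Normc.normcM !normcX normc_expi expr1n !mul1r unit_rootX ltNge.
apply/negP => hj; apply: h; eexists; last exact: hj.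
by rewrite divr_ge0 // mulr_ge0 // mulr_ge0 // pi_ge0.
Qed.

(* The maximum principle for the product of the N rotations of q; as N grows the
   logarithm of this inequality becomes Jensen's inequality, without factoring q. *)
Lemma prod_max_principle (q : {poly R[i]}) N :
  exists2 t, 0 <= t & normc q.[0] ^+ N <=
    \prod_(k < N) normc q.[expi (t + 2 * pi * k%:R / N%:R)].
Proof.
pose H := \prod_(k < N) (q \Po (expi (2 * pi * k%:R / N%:R) *: 'X)).
have [t t0 ht] := max_principle H; exists t => //; move: ht.
rewrite !horner_prod !normc_prod.
under eq_bigr do rewrite horner_comp hornerZ hornerX mulr0.
rewrite prodr_const card_ord => /le_trans; apply.
rewrite le_eqVlt; apply/orP; left; apply/eqP; apply: eq_bigr => k _.
by rewrite horner_comp hornerZ hornerX -expiD addrC.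
Qed.

End complex_modulus.

(** * Riemann sums of periodic functions *)

Section riemann.
Context (R : realType).
Local Notation mu := (@lebesgue_measure R).

Lemma lipschitz_continuous (f : R -> R) (Lam : R) :
  (forall s t, `|f s - f t| <= Lam * `|s - t|) -> continuous f.
Proof.
move=> fL x; apply/cvgrPdist_lt => e e0.
have L0 : 0 <= Lam by have := le_trans (normr_ge0 _) (fL 1 0); rewrite subr0 normr1 mulr1.
have d0 : 0 < e / (Lam + 1) by rewrite divr_gt0 // ltr_wpDl.
near=> y; apply: le_lt_trans (fL _ _) _.
have : `|x - y| < e / (Lam + 1) by near: y; apply: cvgr_dist_lt.
rewrite ltr_pdivlMr ?ltr_wpDl // => h.
by have := normr_ge0 (x - y); nra.
Unshelve. all: by end_near. Qed.

Lemma integral_ge_cells (f : R -> R) (h : R) (m : nat -> R) n :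
  0 <= h -> (forall k, 0 <= m k) -> continuous f -> (forall t, 0 <= f t) ->
  (forall k t, (k < n)%N -> k%:R * h <= t <= k.+1%:R * h -> m k <= f t) ->
  ((\sum_(k < n) m k * h)%:E <=
     \int[mu]_(t in `[0%R, (n%:R * h)%R]) (f t)%:E)%E.
Proof.
move=> h0 m0 fc f0; elim: n => [|n IH] hm.
  by rewrite big_ord0 integral_ge0 // => t _; rewrite lee_fin.
have mf := continuous_measurable_fun fc.
have nn : n%:R * h <= n.+1%:R * h by rewrite ler_wpM2r // ler_nat.
have -> : `[0%R, n.+1%:R * h]%classic =
    `[0%R, n%:R * h]%classic `|` `]n%:R * h, n.+1%:R * h]%classic.
  by rewrite -itv_bndbnd_setU // bnd_simp // mulr_ge0.
rewrite ge0_integral_setU //=; first last.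
- apply/disj_setPS => t /= []; rewrite !in_itv /= => /andP[_ t1] /andP[t2 _].
  by move: (le_lt_trans t1 t2); rewrite ltxx.
- by move=> t _; rewrite lee_fin.
- by apply/measurable_EFinP; exact: measurable_funTS.
rewrite big_ord_recr /= EFinD leeD //.
  by apply: IH => k t kn; apply: hm; rewrite ltnS ltnW.
apply: (@le_trans _ _ (\int[mu]_(t in `](n%:R * h)%R, (n.+1%:R * h)%R]) (m n)%:E)%E).
  rewrite integral_cst //= lebesgue_measure_itv /= lte_fin.
  case: ltP => [_|h2].
    rewrite -EFinB -EFinM lee_fin -mulrBl -natr1.
    by rewrite addrAC subrr add0r mul1r.
  have -> : h = 0.
    apply/eqP; rewrite eq_le h0 andbT.
    by move: h2; rewrite -natr1 mulrDl; lra.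
  by rewrite mulr0 mule0.
apply: ge0_le_integral => //=.
- by move=> t _; rewrite lee_fin.
- by apply/measurable_EFinP; exact: measurable_funTS.
- move=> t; rewrite in_itv /= => /andP[t1 t2]; rewrite lee_fin.
  by apply: (hm n) => //; rewrite ltW.
Qed.

(* The sums over [phi + 2 pi Z / N] are Riemann sums with one point in each cell
   once [phi] is reduced modulo [2 pi / N]. *)
Lemma integral_ge_rotated_means (f : R -> R) (Lam L : R) :
  (forall s t, `|f s - f t| <= Lam * `|s - t|) ->
  (forall t, 0 <= f t) -> (forall t, f (t + 2 * pi) = f t) ->
  (forall N, (0 < N)%N -> exists2 phi : R, 0 <= phi &
     N%:R * L <= \sum_(k < N) f (phi + 2 * pi * k%:R / N%:R)) ->
  ((L * (2 * pi))%:E <= \int[mu]_(t in `[0%R, (2 * pi)%R]) (f t)%:E)%E.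
Proof.
move=> fL f0 fp hN; have fc := lipschitz_continuous fL.
have p0 : 0 < 2 * pi :> R by rewrite mulr_gt0 // pi_gt0.
have L0 : 0 <= Lam by have := le_trans (normr_ge0 _) (fL 1 0); rewrite subr0 normr1 mulr1.
(* The error is of order [1 / N], so it disappears in the limit when the integral is finite; an
   infinite integral is immediate. *)
suff key N : (0 < N)%N -> ((L * (2 * pi) - Lam * (2 * pi) ^+ 2 / N%:R)%:E <=
    \int[mu]_(t in `[0%R, (2 * pi)%R]) (f t)%:E)%E.
  set I := integral _ _ _ in key *.
  have [I0|I0] : I = +oo%E \/ I \is a fin_num.
    have : (0%:E <= I)%E by apply: integral_ge0 => t _; rewrite lee_fin.
    by case: (I) => [r| |] // _; [right|left].
    by rewrite I0 leey.
  move: key; rewrite -(fineK I0); set J := fine I => key.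
  rewrite lee_fin; apply/ler_addgt0Pr => e e0.
  pose N := (Num.truncn (Lam * (2 * pi) ^+ 2 / e)).+1.
  have := key N isT; rewrite lee_fin lerBlDr => /le_trans; apply.
  rewrite lerD2l ler_pdivrMr ?ltr0n // [leRHS]mulrC -ler_pdivrMr // ltW //.
  exact: Num.Theory.truncnS_gt.
move=> N0; have [phi phi0 hphi] := hN N N0.
have NR : 0 < N%:R :> R by rewrite ltr0n.
pose h : R := 2 * pi / N%:R; have h0 : 0 < h by rewrite divr_gt0.
have Nh : N%:R * h = 2 * pi by rewrite mulrC divfK // gt_eqF.
(* A shift by [h] permutes the sample points modulo the period, so [S] has period [h] and [phi] may
   be replaced by [psi] in [[0, h)]. *)
pose S u := \sum_(k < N) f (u + k%:R * h).
have Sp u : S (u + h) = S u.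
  rewrite /S; case: N N0 NR @h h0 Nh @S {hphi hN} => // n _ _ h _ Nh _.
  rewrite big_ord_recr big_ord_recl /= addrC; congr (_ + _).
    by rewrite mul0r addr0 -addrA -{1}[h]mul1r -mulrDl nat1r Nh fp.
  by apply: eq_bigr => k _; rewrite /bump /= -addrA -{1}[h]mul1r -mulrDl natrD.
pose m := Num.truncn (phi / h); pose psi := phi - m%:R * h.
have Spsi : S psi = S phi.
  have Sn n u : S (u + n%:R * h) = S u.
    by elim: n => [|n IH]; rewrite ?mul0r ?addr0 // -natr1 mulrDl mul1r addrA Sp.
  by rewrite -(Sn m) subrK.
have /andP[m1 m2] : m%:R <= phi / h < m.+1%:R.
  by apply: Num.Theory.truncn_itv; rewrite divr_ge0 // ltW.
rewrite ler_pdivlMr // in m1; rewrite ltr_pdivrMr // -natr1 mulrDl mul1r in m2.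
(* The sample point [psi + k h] is within [h] of every point of the [k]-th cell; truncation at 0
   keeps the cell bounds nonnegative. *)
pose g k := Num.max (f (psi + k%:R * h) - Lam * h) 0.
have g0 k : 0 <= g k by rewrite /g le_max lexx orbT.
have gf k t : (k < N)%N -> k%:R * h <= t <= k.+1%:R * h -> g k <= f t.
  move=> _; rewrite -natr1 mulrDl mul1r => /andP[t1 t2].
  rewrite /g ge_max f0 andbT lerBlDr.
  have : `|psi + k%:R * h - t| <= h by rewrite ler_norml /psi; apply/andP; split; lra.
  move=> /(ler_wpM2l L0) /(le_trans (fL _ _)).
  by rewrite ler_norml => /andP[_]; lra.
have := integral_ge_cells (ltW h0) g0 fc f0 gf; rewrite Nh; apply: le_trans.
rewrite lee_fin -mulr_suml.
apply: (@le_trans _ _ ((S psi - N%:R * (Lam * h)) * h)); last first.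
  rewrite ler_pM2r // /S mulr_natl -[X in _ *+ X](card_ord N) -sumr_const -sumrB.
  by apply: ler_sum => k _; rewrite /g le_max lexx.
rewrite Spsi; apply: (@le_trans _ _ ((N%:R * L - N%:R * (Lam * h)) * h)).
  rewrite /h le_eqVlt; apply/orP; left; apply/eqP; field.
  by rewrite gt_eqF.
rewrite ler_pM2r // lerD2r; apply: (le_trans hphi).
rewrite le_eqVlt; apply/orP; left; apply/eqP; apply: eq_bigr => k _.
by rewrite /h [k%:R * _]mulrC [in RHS]mulrAC.
Qed.

End riemann.

(** * Jensen's inequality *)

Section jensen.
Context (R : realType).
Implicit Types (q : {poly R[i]}).
Local Notation normc := Normc.normc.
Local Notation expi := (@expi R).
Local Notation mu := (@lebesgue_measure R).

(** The positive part of the logarithm: finite everywhere, nonnegative and 1-Lipschitz, yet Jensen's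
    inequality survives for it. *)
Definition lnp (x : R) : R := ln (Num.max x 1).

Lemma max1_gt0 (x : R) : 0 < Num.max x 1.
Proof. by rewrite lt_max ltr01 orbT. Qed.

Lemma expR_lnp x : expR (lnp x) = Num.max x 1.
Proof. by rewrite lnK // posrE max1_gt0. Qed.

Lemma lnp_ge0 x : 0 <= lnp x.
Proof. by rewrite ln_ge0 // le_max lexx orbT. Qed.

Lemma lnp0 x : x <= 1 -> lnp x = 0.
Proof. by move=> x1; rewrite /lnp max_r // ln1. Qed.

Lemma ler_lnp x y : x <= y -> lnp x <= lnp y.
Proof.
move=> xy; rewrite -ler_expR !expR_lnp ge_max le_max xy /=.
by rewrite le_max lexx orbT.
Qed.

(** For [1 <= u <= v], [ln (v / u) <= v / u - 1 <= v - u]; capping below at 1 only shrinks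
    differences. *)
Lemma lnp_lipschitz x y : `|lnp x - lnp y| <= `|x - y|.
Proof.
have h u v : u <= v -> lnp v - lnp u <= v - u.
  move=> uv; rewrite -ln_div ?posrE ?max1_gt0 //.
  have -> : Num.max v 1 / Num.max u 1 = 1 + (Num.max v 1 - Num.max u 1) / Num.max u 1.
    by rewrite mulrBl divff ?gt_eqF ?max1_gt0 // addrC subrK.
  have uv1 : Num.max u 1 <= Num.max v 1 by rewrite -!expR_lnp ler_expR ler_lnp.
  have u1 : 1 <= Num.max u 1 by rewrite le_max lexx orbT.
  apply: le_trans (le_ln1Dx _) _.
    apply: (@lt_le_trans _ _ 0); rewrite ?ltrN10 //.
    by rewrite divr_ge0 ?subr_ge0 // ltW ?max1_gt0.
  apply: (@le_trans _ _ (Num.max v 1 - Num.max u 1)).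
    by rewrite ler_pdivrMr ?max1_gt0 // ler_peMr // subr_ge0.
  by case: (leP u 1) => u1'; case: (leP v 1) => v1; lra.
have [xy|/ltW yx] := leP x y.
  by rewrite distrC (distrC x) !ger0_norm ?subr_ge0 ?ler_lnp // h.
by rewrite !ger0_norm ?subr_ge0 ?ler_lnp // h.
Qed.

Lemma horner_expi_lipschitz q : exists Lam : R, forall s t : R,
  `|normc q.[expi s] - normc q.[expi t]| <= Lam * `|s - t|.
Proof.
exists (\sum_(i < size q) normc q`_i * (2 * i%:R)) => s t.
apply: le_trans (ler_dist_normc _ _) _.
rewrite !horner_coef -sumrB mulr_suml; apply: le_trans (le_normc_sum _ _ _) _.
apply: ler_sum => i _; rewrite -mulrBr Normc.normcM !expiX -!mulrA.
rewrite ler_wpM2l ?normc_ge0 //; apply: le_trans (expi_lipschitz _ _) _.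
by rewrite -mulrnBl normrMn [i%:R * _]mulr_natl.
Qed.

Lemma prod_max1 (I : Type) (r : seq I) (F : I -> R) :
  (forall i, 0 <= F i) -> \prod_(i <- r) F i <= expR (\sum_(i <- r) lnp (F i)).
Proof.
move=> F0; rewrite expR_sum; apply: ler_prod => i _.
by rewrite F0 expR_lnp le_max lexx.
Qed.

(** If [|q(0)| <= 1] the left side is 0. Otherwise the logarithm of the product inequality bounds
    the rotated means of [lnp |q|] from below, and these converge to the integral. *)
Lemma jensen_lnp q :
  ((lnp (normc q.[0]))%:E <= ((2 * pi)^-1)%:E *
    \int[mu]_(t in `[0%R, (2 * pi)%R]) (lnp (normc q.[expi t]))%:E)%E.
Proof.
have p0 : 0 < 2 * pi :> R by rewrite mulr_gt0 // pi_gt0.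
rewrite muleC lee_pdivlMr //.
have [Lam hLam] := horner_expi_lipschitz q.
apply: (@integral_ge_rotated_means R (fun t => lnp (normc q.[expi t])) Lam).
- by move=> s t; apply: le_trans (hLam s t); exact: lnp_lipschitz.
- by move=> t; exact: lnp_ge0.
- by move=> t; rewrite expiD expi2pi mulr1.
move=> N N0; have [q1|/ltW q1] := leP (normc q.[0]) 1.
  by exists 0 => //; rewrite lnp0 // mulr0 sumr_ge0 // => k _; exact: lnp_ge0.
have [phi phi0 hphi] := prod_max_principle q N; exists phi => //.
rewrite -ler_expR mulrC expRM_natr expR_lnp max_l //.
apply: (le_trans hphi); apply: prod_max1 => k; exact: normc_ge0.
Qed.

End jensen.

(** * Logarithms of polynomials *)

Lemma continuous_meval (K : numFieldType) (d : nat) (p : mpoly d K) :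
  continuous (fun z : 'rV[K]_d => meval (fun i => z ord0 i) p).
Proof.
have cX i n : continuous (fun z : 'rV[K]_d => z ord0 i ^+ n).
  elim: n => [|n IH].
    by under eq_fun do rewrite expr0; exact: cst_continuous.
  under eq_fun do rewrite exprS.
  by move=> z; exact: (cvgM (@coord_continuous K 1 d ord0 i z) (IH z)).
have cP (m : multinom d) : continuous (fun z : 'rV[K]_d => \prod_i z ord0 i ^+ m i).
  apply: continuous_big => // -[x y].
  by apply: cvgM; [exact: cvg_fst|exact: cvg_snd].
have -> : (fun z : 'rV[K]_d => meval (fun i => z ord0 i) p) =
    fun z => \sum_(m <- msupp p) mcoeff m p * \prod_i z ord0 i ^+ m i.
  by apply/funext => z; exact: mevalE.
apply: continuous_big => [[x y]|m _ z].
  by apply: cvgD; [exact: cvg_fst|exact: cvg_snd].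
exact: (cvgMl_tmp (cP m z)).
Qed.

Section log_polynomial.
Context (R : realType) (d : nat).
Implicit Types (p : mpoly d R[i]) (z a b : cspace R d).
Local Notation normc := Normc.normc.
Local Notation mu := (@lebesgue_measure R).

Lemma pevalE p z :
  peval p z = \sum_(m <- msupp p) mcoeff m p * \prod_i z ord0 i ^+ m i.
Proof. exact: mevalE. Qed.

Lemma continuous_normc : continuous (fun x : (R[i])^o => normc x : R).
Proof.
move=> x; apply/(@cvgrPdist_lt _ _ _ _ (nbhs_filter (x : (R[i])^o))) => e e0.
have e0c : (0 : R[i]) < real_complex R e by rewrite ltcR.
apply/nbhs_ballP; exists (real_complex R e) => // y; rewrite /ball /= ltcR.
exact/le_lt_trans/ler_dist_normc.
Qed.

Lemma continuous_peval p : continuous (peval p : cspace R d -> (R[i])^o).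
Proof. exact: (@continuous_meval R[i] d p). Qed.

Lemma cnorm_coord z i : normc (z ord0 i) <= cnorm z.
Proof.
rewrite -[leLHS]ger0_norm ?normc_ge0 // -sqrtr_sqr ler_wsqrtr //.
by rewrite (bigD1 i) //= lerDl sumr_ge0 // => j _; rewrite sqr_ge0.
Qed.

Definition coef_norm p : R := \sum_(m <- msupp p) normc (mcoeff m p).

Lemma normc_peval_le p n z (r : R) :
  (forall m, m \in msupp p -> (mdeg m <= n)%N) -> 1 <= r ->
  (forall i, normc (z ord0 i) <= r) -> normc (peval p z) <= coef_norm p * r ^+ n.
Proof.
move=> pn r1 zr; rewrite pevalE mulr_suml; apply: le_trans (le_normc_sum _ _ _) _.
rewrite big_seq [leRHS]big_seq; apply: ler_sum => m mp.
rewrite Normc.normcM ler_wpM2l ?normc_ge0 // normc_prod.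
apply: (@le_trans _ _ (\prod_(i < d) r ^+ m i)).
  apply: ler_prod => i _; rewrite normcX exprn_ge0 ?normc_ge0 //=.
  by rewrite lerXn2r ?nnegrE ?normc_ge0 // (le_trans ler01).
by rewrite prodrXr -mdegE ler_weXn2l // pn.
Qed.

(** The competitor for the extremal function; with [lnp] it is real-valued and continuous even at
    zeros of [p]. *)
Definition log_poly p n z : \bar R := (lnp (normc (peval p z)) / n%:R)%:E.

(** Restriction to a complex line, which reduces the sub-mean value inequality and polynomial growth
    to one variable. *)
Definition line_poly p a b : {poly R[i]} :=
  \sum_(m <- msupp p) (mcoeff m p)%:P *
    \prod_(i < d) ((a ord0 i)%:P + b ord0 i *: 'X) ^+ m i.

Lemma horner_line_poly p a b x : (line_poly p a b).[x] = peval p (a + x *: b).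
Proof.
rewrite pevalE horner_sum; apply: eq_bigr => m _.
rewrite hornerM hornerC horner_prod; congr (_ * _); apply: eq_bigr => i _.
by rewrite horner_exp !(hornerE, mxE) mulrC.
Qed.

(** Upper semicontinuity comes from continuity, and the sub-mean value inequality on a line is
    Jensen's inequality for [line_poly]. *)
Lemma plurisubharmonic_log_poly p n : plurisubharmonic (log_poly p n).
Proof.
split => [z||z c|a b].
- by rewrite ltry.
- by exists 0.
- move=> hc0; have hc : c < - (lnp (normc (peval p z)) / n%:R) by rewrite -lte_fin.
  have cn : continuous (fun y : cspace R d => normc (peval p y) : R).
    move=> y; apply: (@continuous_comp _ (R[i])^o _ (peval p)
      (fun x : (R[i])^o => normc x : R)).
      exact: continuous_peval.
    exact: continuous_normc.
  have cl : continuous (@lnp R).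
    apply: (@lipschitz_continuous R _ 1) => s t.
    by rewrite mul1r; exact: lnp_lipschitz.
  have cont y : {for y, continuous
      (fun y : cspace R d => lnp (normc (peval p y)) / n%:R)}.
    exact: (cvgMr_tmp (continuous_comp (cn y) (cl _))).
  exists [set y | lnp (normc (peval p y)) / n%:R < - c].
    by apply: (cvgr_lt (lnp (normc (peval p z)) / n%:R) (cont z)); rewrite ltrNr.
  by move=> y; rewrite /= ltrNr -lte_fin.
have q0 : peval p a = (line_poly p a b).[0].
  by rewrite horner_line_poly scale0r addr0.
rewrite {1}/log_poly q0.
under eq_integral do rewrite /log_poly -horner_line_poly mulrC EFinM.
rewrite ge0_integralZl //=; first last.
- by move=> t _; rewrite lee_fin lnp_ge0.
- apply/measurable_EFinP; apply: measurable_funTS.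
  apply: continuous_measurable_fun.
  have [Lam hLam] := horner_expi_lipschitz (line_poly p a b).
  apply: (@lipschitz_continuous R _ Lam) => s t.
  exact: le_trans (lnp_lipschitz _ _) (hLam s t).
rewrite muleCA mulrC EFinM lee_wpmul2l ?lee_fin ?invr_ge0 //.
exact: jensen_lnp.
Qed.

Lemma lelong_log_poly p n : (0 < n)%N ->
  (forall m, m \in msupp p -> (mdeg m <= n)%N) -> lelong_class (log_poly p n).
Proof.
move=> n0 pn; split; first exact: plurisubharmonic_log_poly.
have C0 : 0 <= coef_norm p by apply: sumr_ge0 => m _; exact: normc_ge0.
(* Adding 1 keeps the logarithm meaningful for [p = 0] and makes the bound dominate the cap 1 inside
   [lnp]. *)
exists 1, (ln (coef_norm p + 1) / n%:R) => z z1.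
have nR : 0 < n%:R :> R by rewrite ltr0n.
rewrite lee_fin ler_pdivrMr // mulrDl divfK ?gt_eqF //.
have zn1 : 1 <= cnorm z ^+ n by rewrite exprn_ege1.
rewrite mulr_natr -lnXn ?(lt_le_trans ltr01) // -lnM ?posrE ?ltr_wpDl //; last first.
  exact: lt_le_trans zn1.
rewrite /lnp ler_ln ?posrE ?max1_gt0 //; last first.
  by rewrite mulr_gt0 ?ltr_wpDl // (lt_le_trans ltr01).
rewrite ge_max; apply/andP; split.
  apply: le_trans (normc_peval_le pn z1 (cnorm_coord z)) _.
  by rewrite mulrC ler_wpM2l ?lerDl // (le_trans ler01).
by rewrite mulr_ege1 // lerDr.
Qed.

(** [log_poly] of [p / m] lies in the Lelong class and vanishes on [E], because [lnp] is 0 on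
    [[0, 1]]; so it is at most the extremal function of [E]. *)
Lemma bernstein_walsh (E : set (cspace R d)) p n (m lam : R) z :
  (0 < n)%N -> (forall c, c \in msupp p -> (mdeg c <= n)%N) ->
  0 < m -> 1 <= lam -> (forall x, E x -> normc (peval p x) <= m) ->
  (extremal E z <= (ln lam)%:E)%E -> normc (peval p z) <= m * lam ^+ n.
Proof.
move=> n0 pn m0 lam1 hm hV.
have mc : normc (real_complex R m^-1) = m^-1.
  by rewrite normc_real ger0_norm // invr_ge0 ltW.
pose p' := real_complex R m^-1 *: p.
have p'E x : normc (peval p' x) = normc (peval p x) / m.
  by rewrite /peval mevalZ Normc.normcM mc mulrC.
have p'n c : c \in msupp p' -> (mdeg c <= n)%N.
  by move=> /msuppZ_le; exact: pn.
have nR : 0 < n%:R :> R by rewrite ltr0n.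
have lam0 : 0 < lam by apply: lt_le_trans lam1.
have : (log_poly p' n z <= (ln lam)%:E)%E.
  apply: le_trans hV; apply: ereal_sup_ubound; exists (log_poly p' n) => //.
  split; first exact: lelong_log_poly.
  move=> x Ex; rewrite /log_poly lnp0 ?mul0r //.
  by rewrite p'E ler_pdivrMr // mul1r hm.
rewrite lee_fin ler_pdivrMr // mulr_natr -lnXn // -ler_expR expR_lnp lnK; last first.
  by rewrite posrE exprn_gt0.
by rewrite ge_max p'E ler_pdivrMr // mulrC => /andP[].
Qed.

End log_polynomial.

(** * Leading exponents and Cauchy estimates *)

Section monomial_order.
Context (d : nat).
Implicit Types (a b c x : multinom d).

(** Cancellation is what lets differentiation, a shift of exponents by [c], respect leading
    exponents. *)
Lemma glex_lt_add2l c x b : glex_lt (mnm_add c x) (mnm_add c b) -> glex_lt x b.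
Proof.
rewrite /glex_lt !mdegD; case => [|[]]; first by rewrite ltn_add2l; left.
move=> /eqP; rewrite eqn_add2l => /eqP e [k [h1 h2]]; right; split => //.
exists k; split; last by move: h2; rewrite !mnmDE ltn_add2l.
by move=> i /h1; rewrite !mnmDE => /eqP; rewrite eqn_add2l => /eqP.
Qed.

(** When both degrees tie, the sums are compared at the smaller of the two first differing
    indices. *)
Lemma glex_lt_addl a b a' b' : glex_lt a' a -> b' = b \/ glex_lt b' b ->
  glex_lt (mnm_add a' b') (mnm_add a b).
Proof.
move=> ha [->|hb].
- case: ha => [h|[e [k [h1 h2]]]]; [left|right]; rewrite !mdegD ?ltn_add2r ?e //.
  split=> //; exists k; split; last by rewrite !mnmDE ltn_add2r.
  by move=> i /h1; rewrite !mnmDE => ->.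
- case: ha hb => [h|[e [k [h1 h2]]]] [h'|[e' [k' [h1' h2']]]].
  + by left; rewrite !mdegD -addSn leq_add // ltnW.
  + by left; rewrite !mdegD e' ltn_add2r.
  + by left; rewrite !mdegD e ltn_add2l.
  right; rewrite !mdegD e e'; split => //.
  have [kk'|k'k|kk'] := ltngtP k k'.
  + exists k; split; last by rewrite !mnmDE (h1' _ kk') ltn_add2r.
    by move=> i ik; rewrite !mnmDE (h1 _ ik) (h1' _ (ltn_trans ik kk')).
  + exists k'; split; last by rewrite !mnmDE (h1 _ k'k) ltn_add2l.
    by move=> i ik; rewrite !mnmDE (h1' _ ik) (h1 _ (ltn_trans ik k'k)).
  + have {}kk' : k = k' by apply: val_inj.
    exists k; split; last by rewrite !mnmDE -addSn leq_add // kk' // ltnW.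
    by move=> i ik; rewrite !mnmDE (h1 _ ik) h1' // -kk'.
Qed.

Lemma glex_lt_add a b a' b' : a' = a \/ glex_lt a' a -> b' = b \/ glex_lt b' b ->
  mnm_add a' b' = mnm_add a b \/ glex_lt (mnm_add a' b') (mnm_add a b).
Proof.
case=> [->|ha] hb; last by right; exact: glex_lt_addl.
case: hb => [->|hb]; first by left.
by right; rewrite addmC (addmC a b); apply: glex_lt_addl hb _; left.
Qed.

Lemma glex_lt_irr a : ~ glex_lt a a.
Proof. by case=> [|[_ [k []]]]; rewrite ltnn. Qed.

Lemma glex_le_mdeg a b : b = a \/ glex_lt b a -> (mdeg b <= mdeg a)%N.
Proof. by case=> [->//|[/ltnW//|[->]]]. Qed.

End monomial_order.

(** * Cauchy's inequalities for mixed derivatives *)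

Section cauchy.
Context (R : realType) (d : nat).
Implicit Types (p : mpoly d R[i]) (z x : cspace R d) (b c m : multinom d).
Local Notation normc := Normc.normc.

Lemma coef_CaddXn (x : R[i]) n k :
  ((x%:P + 'X) ^+ n)`_k = ('C(n, k))%:R * x ^+ (n - k).
Proof.
rewrite exprDn coef_sum.
under eq_bigr do rewrite coefMn -polyC_exp coefCM coefXn.
have [kn|nk] := leqP k n; last first.
  rewrite bin_small // mul0r big1 // => i _.
  by rewrite gtn_eqF ?mulr0 ?mul0rn // (leq_ltn_trans _ nk) // -ltnS ltn_ord.
rewrite (bigD1 (inord k : 'I_n.+1)) //= inordK // eqxx mulr1 mulr_natl big1 ?addr0 //.
move=> i ik; rewrite [k == i]negbTE ?mulr0 ?mul0rn //.
by apply: contra ik => /eqP e; rewrite -val_eqE /= inordK // e.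
Qed.

Lemma unit_root_average_expn (x dl : R[i]) N n k : (n < N)%N -> (k < N)%N ->
  \sum_(j < N) unit_root R N ^+ ((N - k) * j) * (x + dl * unit_root R N ^+ j) ^+ n =
  N%:R * (('C(n, k))%:R * x ^+ (n - k) * dl ^+ k).
Proof.
move=> nN kN; rewrite -coef_CaddXn -coef_average //; last first.
  apply: leq_trans (size_poly_exp_leq _ _) _.
  by rewrite addrC size_XaddC mul1n.
by apply: eq_bigr => j _; rewrite horner_exp hornerD hornerC hornerX.
Qed.

Lemma peval_mderivm p c z : peval (mderivm c p) z =
  (\prod_i (c i)`!)%:R * \sum_(m <- msupp p) mcoeff m p *
     \prod_i (('C(m i, c i))%:R * z ord0 i ^+ (m i - c i)).
Proof.
rewrite mderivmE /peval raddf_sum mulr_sumr; apply: eq_bigr => m _ /=.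
rewrite mevalZ mevalX -mulrA [RHS]mulrCA; congr (_ * _).
rewrite !natr_prod -!big_split /=; apply: eq_bigr => i _.
by rewrite mulrA -natrM mulnC bin_ffact mnmBE.
Qed.

(** The Taylor coefficient of order [c] at [z] is a weighted average of [p] over a grid of [N ^ d]
    points on the torus of radius [dl], with weights of modulus 1. *)
Lemma cauchy_mderivm p c z (dl B : R) : 0 <= dl ->
  (forall x, (forall i, normc (x ord0 i - z ord0 i) <= dl) -> normc (peval p x) <= B) ->
  normc (peval (mderivm c p) z) * dl ^+ mdeg c <= (\prod_i (c i)`!)%:R * B.
Proof.
(* [N] exceeds every exponent of [p] and of [c], which makes the averages exact in each variable. *)
move=> dl0 hB; pose N := (\max_(m <- msupp p) mdeg m + mdeg c).+1.
have le_mdeg m i : (m i <= mdeg m)%N by rewrite mdegE (bigD1 i) //= leq_addr.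
have mN m i : m \in msupp p -> (m i < N)%N.
  move=> mp; rewrite ltnS (leq_trans (le_mdeg m i)) //.
  by rewrite (leq_trans _ (leq_addr _ _)) // (leq_bigmax_seq _ mp).
have cN i : (c i < N)%N by rewrite ltnS (leq_trans (le_mdeg c i)) // leq_addl.
pose w := unit_root R N; pose dc := real_complex R dl.
pose pt (f : {ffun 'I_d -> 'I_N}) : cspace R d := \row_i (z ord0 i + dc * w ^+ f i).
pose S := \sum_(m <- msupp p) mcoeff m p *
     \prod_i (('C(m i, c i))%:R * z ord0 i ^+ (m i - c i)).
have key : \sum_(f : {ffun 'I_d -> 'I_N})
      (\prod_i w ^+ ((N - c i) * f i)) * peval p (pt f) =
    N%:R ^+ d * (dc ^+ mdeg c * S).
  under eq_bigr do rewrite pevalE mulr_sumr.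
  rewrite exchange_big /= !mulr_sumr big_seq [RHS]big_seq; apply: eq_bigr => m mp.
  transitivity (mcoeff m p * \sum_(f : {ffun 'I_d -> 'I_N}) \prod_i
      (w ^+ ((N - c i) * f i) * (z ord0 i + dc * w ^+ f i) ^+ m i)).
    rewrite mulr_sumr; apply: eq_bigr => f _; rewrite mulrCA; congr (_ * _).
    by rewrite -big_split; apply: eq_bigr => i _; rewrite mxE.
  (* For a monomial the sum over the grid factors into one-variable averages. *)
  rewrite -(bigA_distr_bigA (fun i (j : 'I_N) =>
      w ^+ ((N - c i) * j) * (z ord0 i + dc * w ^+ j) ^+ m i)).
  under eq_bigr => i _ do rewrite (unit_root_average_expn _ _ (mN _ _ mp) (cN i)).
  rewrite big_split prodr_const card_ord big_split /= prodrXr -mdegE.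
  rewrite mulrCA [dc ^+ _ * _]mulrC -!mulrA [RHS]mulrCA.
  by congr (_ * _); exact: mulrCA.
rewrite peval_mderivm -/S Normc.normcM normc_nat -mulrA ler_wpM2l //.
have NR : 0 < N%:R ^+ d :> R by rewrite exprn_gt0 // ltr0n.
rewrite -(ler_pM2l NR).
have -> : N%:R ^+ d * (normc S * dl ^+ mdeg c) = normc (N%:R ^+ d * (dc ^+ mdeg c * S)).
  rewrite !Normc.normcM !normcX normc_nat normc_real ger0_norm //.
  by rewrite [normc S * _]mulrC.
rewrite -key; apply: le_trans (le_normc_sum _ _ _) _.
have -> : N%:R ^+ d * B = \sum_(f : {ffun 'I_d -> 'I_N}) B.
  by rewrite sumr_const card_ffun !card_ord -natrX mulr_natl.
apply: ler_sum => f _; rewrite Normc.normcM normc_prod big1 ?mul1r; last first.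
  by move=> i _; rewrite normcX normc_expi expr1n.
apply: hB => i; rewrite mxE addrC addKr Normc.normcM normcX normc_expi expr1n mulr1.
by rewrite normc_real ger0_norm.
Qed.

End cauchy.

(** * Uniformity over compact sets *)

Section uniform_radius.
Context (R : realType) (d : nat).
Implicit Types (K U : set (cspace R d)) (x y z : cspace R d).
Local Notation normc := Normc.normc.

(** The balls of [cspace] have complex radii; this is the same neighbourhood base with real ones. *)
Definition polydisc y (r : R) : set (cspace R d) :=
  [set x | forall i, normc (x ord0 i - y ord0 i) < r].

Lemma polydisc_trans x y z r s : polydisc y r x -> polydisc z s y ->
  polydisc z (r + s) x.
Proof.
move=> xy yz i; rewrite -(subrKA (y ord0 i)).
by apply: le_lt_trans (le_normcD _ _) _; exact: ltrD.
Qed.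

Lemma polydisc_le x y r s : r <= s -> polydisc y r x -> polydisc y s x.
Proof. by move=> rs xy i; exact: lt_le_trans (xy i) rs. Qed.

Lemma ballE_polydisc y (r : R) x : 0 < r ->
  ball y (real_complex R r) x <-> polydisc y r x.
Proof.
move=> r0; split=> [[_ h] i|h].
  by have := h ord0 i; rewrite /ball /= ltcR -normcN opprB.
split; first by rewrite ltcR.
move=> i j; rewrite ord1 /ball /= ltcR -normcN opprB; exact: h.
Qed.

Lemma nbhs_polydisc y r : 0 < r -> nbhs y (polydisc y r).
Proof.
move=> r0; apply/nbhs_ballP; exists (real_complex R r); first by rewrite /= ltcR.
by move=> x /ballE_polydisc; exact.
Qed.

Lemma nbhs_subset_polydisc y U : nbhs y U -> exists2 r, 0 < r & polydisc y r `<=` U.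
Proof.
move=> /nbhs_ballP[[e e'] /= e0 eU].
(* A positive complex radius has zero imaginary part. *)
have [e'0 er] : e' = 0 /\ 0 < e by move: e0; rewrite ltcE /= => /andP[/eqP -> ->].
by exists e => // x /ballE_polydisc h; apply: eU; rewrite e'0; exact: h.
Qed.

(** The near-covering form of compactness, for the filter of radii decreasing to 0, merges local
    radii into a single one. *)
Lemma compact_uniform K (Q : R -> cspace R d -> Prop) : compact K ->
  (forall z, K z -> exists2 r, 0 < r & forall y (dl : R), K y -> polydisc z r y ->
     0 < dl < r -> Q dl y) ->
  exists2 dl, 0 < dl & forall y, K y -> Q dl y.
Proof.
move=> /compact_near_coveringP cK hQ.
have /(cK R (at_right 0) (fun dl y => K y -> Q dl y)) : forall z, K z ->
    \forall y \near z & dl \near at_right (0 : R), K y -> Q dl y.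
  move=> z Kz; have [r r0 h] := hQ z Kz.
  exists (polydisc z r, [set dl | 0 < dl < r]) => /=.
    split; first exact: nbhs_polydisc.
    near=> dl; apply/andP; split; first by near: dl; exact: nbhs_right_gt.
    by near: dl; exact: nbhs_right_lt.
  by move=> [y dl] /= [zy dlr] Ky; exact: h.
move=> [e /= e0 he].
exists (e / 2); first by rewrite divr_gt0.
move=> y Ky; apply: (he (e / 2)) => //=; last by rewrite divr_gt0.
by rewrite sub0r normrN gtr0_norm ?divr_gt0 // ltr_pdivrMr // ltr_pMr // ltr1n.
Unshelve. all: by end_near. Qed.

(** The uniform small [dl] is used as the inverse of a bound, so that compactness yields
    boundedness. *)
Lemma compact_coord_bounded K : compact K ->
  exists2 B : R, 1 <= B & forall z, K z -> forall i, normc (z ord0 i) <= B.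
Proof.
move=> cK.
have [z _|dl dl0 h] := compact_uniform
  (Q := fun dl y => forall i, normc (y ord0 i) <= dl^-1) cK.
  pose s := cnorm z + 1; have s0 : 0 < s by rewrite ltr_wpDl // sqrtr_ge0.
  exists (Num.min 1 s^-1); first by rewrite lt_min ltr01 invr_gt0.
  move=> y dl _ zy /andP[dl0]; rewrite lt_min => /andP[_ dls] i.
  rewrite -[leRHS]invrK; apply: (@le_trans _ _ s).
    have := zy i; rewrite lt_min => /andP[/ltW h _].
    rewrite -(subrK (z ord0 i) (y ord0 i)); apply: le_trans (le_normcD _ _) _.
    by rewrite /s addrC lerD // cnorm_coord.
  by rewrite invrK -[leLHS]invrK lef_pV2 ?posrE ?invr_gt0 // ltW.
exists (Num.max 1 dl^-1); first by rewrite le_max lexx.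
by move=> z Kz i; rewrite le_max h ?orbT.
Qed.

Lemma within_continuous_near K (w : cspace R d -> R) z (e : R) :
  {within K, continuous w} -> K z -> 0 < e ->
  exists2 r, 0 < r & forall y, K y -> polydisc z r y -> `|w z - w y| < e.
Proof.
move=> /subspace_continuousP wc Kz e0.
have /cvgrPdist_lt/(_ e e0) := wc z Kz.
by move=> /nbhs_subset_polydisc[r r0 h]; exists r => // y Ky /h; exact.
Qed.

Lemma compact_weight_bounded K (w : cspace R d -> R) : compact K ->
  {within K, continuous w} -> exists2 W : R, 1 <= W & forall z, K z -> w z <= W.
Proof.
move=> cK wc.
have [z Kz|dl dl0 h] := compact_uniform (Q := fun dl y => w y <= dl^-1) cK.
  have [r r0 hr] := within_continuous_near wc Kz ltr01.
  pose s := `|w z| + 1; have s0 : 0 < s by rewrite ltr_wpDl.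
  exists (Num.min r s^-1); first by rewrite lt_min r0 invr_gt0.
  move=> y dl Ky zy /andP[dl0]; rewrite lt_min => /andP[_ dls].
  apply: (@le_trans _ _ s).
    have /(hr y Ky) : polydisc z r y by apply: polydisc_le zy; rewrite ge_min lexx.
    rewrite ltr_norml => /andP[h _]; have := ler_norm (w z); rewrite /s; lra.
  by rewrite -[leLHS]invrK lef_pV2 ?posrE ?invr_gt0 // ltW.
exists (Num.max 1 dl^-1); first by rewrite le_max lexx.
by move=> z Kz; rewrite le_max h ?orbT.
Qed.

End uniform_radius.

(** * Polynomials near K *)

Section local_bounds.
Context (R : realType) (d : nat).
Implicit Types (K : set (cspace R d)) (w : cspace R d -> R) (x y z : cspace R d).
Implicit Types (p : mpoly d R[i]) (n k : nat).
Local Notation normc := Normc.normc.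

Definition deg_le p n := forall c, c \in msupp p -> (mdeg c <= n)%N.

Definition weighted_le K w n p (m : R) :=
  forall z, K z -> w z ^+ n * normc (peval p z) <= m.

(** Prepared for derivatives of order [k]: these carry the weight to the power [n - k] only, and a
    loss [D ^ k] is affordable since Cauchy's inequality costs a [k]-th power anyway. *)
Definition local_bound K w := forall lam : R, 1 < lam ->
  exists dl D : R, [/\ 0 < dl, 1 <= D & forall y x n k p (m : R), K y ->
    polydisc y dl x -> (0 < n)%N -> (k <= n)%N -> deg_le p n -> 0 < m ->
    weighted_le K w n p m ->
    w y ^+ (n - k) * normc (peval p x) <= m * lam ^+ n * D ^+ k].

Lemma extremal_le0 K z : K z -> (extremal K z <= 0)%E.
Proof. by move=> Kz; apply: ge_ereal_sup => _ [u [_ uK] <-]; exact: uK. Qed.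

(** The extremal function is at most 0 on [K] and continuous there, hence below [ln lam] on a
    uniform neighbourhood, where Bernstein-Walsh applies. *)
Lemma local_bound_regular K : compact K -> regular K -> local_bound K (fun=> 1).
Proof.
move=> cK rK lam lam1; have lnl : 0 < ln lam by rewrite ln_gt0.
have [z Kz|dl dl0 h] := compact_uniform
  (Q := fun dl y => forall x, polydisc y dl x -> (extremal K x <= (ln lam)%:E)%E) cK.
  have : nbhs z (extremal K @^-1` [set t | (t < (ln lam)%:E)%E]).
    apply: (rK z Kz); apply: open_nbhs_nbhs; split; first exact: open_ereal_lt_ereal.
    by apply: le_lt_trans (extremal_le0 Kz) _; rewrite lte_fin.
  move=> /nbhs_subset_polydisc[r r0 h].
  exists (r / 2) => [|y dl Ky zy /andP[dl0 dlr] x yx]; first by rewrite divr_gt0.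
  apply: ltW; apply: (h x); apply: polydisc_le (polydisc_trans yx zy); lra.
exists dl, 1; split => // y x n k p m Ky yx n0 _ pn m0 hp.
rewrite !expr1n mul1r mulr1.
apply: (bernstein_walsh (E := K) n0 pn m0 (ltW lam1)); last exact: h yx.
by move=> z /hp; rewrite expr1n mul1r.
Qed.

Lemma cball_coord a x (r : R) : cball a r x -> forall i, normc (x ord0 i - a ord0 i) <= r.
Proof.
by move=> h i; apply: le_trans _ h; have := cnorm_coord (x - a) i; rewrite !mxE.
Qed.

(** * Weighted bounds under local regularity *)

Section weighted.
Variables (K : set (cspace R d)) (w : cspace R d -> R).
Hypotheses (lK : locally_regular K) (wc : {within K, continuous w}).
Hypothesis w0 : forall z, K z -> 0 <= w z.

(** Near [a] the weight is almost constant, so [p] is bounded on [K] intersected with a small ball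
    at the cost of one [mu ^ n]; Bernstein-Walsh for that piece of [K] costs the other. *)
Lemma local_estimate a (mu : R) : K a -> 0 < w a -> 1 < mu ->
  exists2 r, 0 < r & forall x, polydisc a r x ->
    (K x -> w x <= mu * w a) /\
    forall n p m, (0 < n)%N -> deg_le p n -> 0 < m -> weighted_le K w n p m ->
      w a ^+ n * normc (peval p x) <= m * mu ^+ n * mu ^+ n.
Proof.
move=> Ka wa mu1; have mu0 : 0 < mu by apply: lt_trans mu1.
(* A variation below [e] keeps [w] between [w a / mu] and [mu * w a]. *)
pose e := w a * (1 - mu^-1).
have mui : mu^-1 < 1 by rewrite invf_lt1.
have e0 : 0 < e by rewrite mulr_gt0 // subr_gt0.
have [r r0 hr] := within_continuous_near wc Ka e0.
have wmu : e <= (mu - 1) * w a.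
  rewrite /e mulrC ler_pM2r //.
  have : mu * mu^-1 = 1 by rewrite divff // gt_eqF.
  have : 0 < mu^-1 by rewrite invr_gt0.
  nra.
have wlow z : K z -> cball a (r / 2) z -> w a / mu <= w z.
  move=> Kz az; have : polydisc a r z.
    by move=> i; apply: le_lt_trans (cball_coord az i) _; lra.
  move=> /(hr z Kz); rewrite ltr_norml /e => /andP[_]; lra.
have reg := lK Ka (divr_gt0 r0 (ltr0Sn _ 1)).
have : (extremal_reg (K `&` cball a (r / 2)) a < (ln mu)%:E)%E.
  by rewrite reg lte_fin ln_gt0.
(* The regularised function is an infimum over neighbourhoods of suprema; [V] is one whose supremum
   is below [ln mu]. *)
move=> /ereal_inf_lt[_ [V Va <-] hV].
have [r' r'0 hr'] := nbhs_subset_polydisc Va.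
exists (Num.min r r'); first by rewrite lt_min r0.
move=> x ax; have axr : polydisc a r x by apply: polydisc_le ax; rewrite ge_min lexx.
split=> [Kx|n p m n0 pn m0 hp].
  by have := hr x Kx axr; rewrite ltr_norml => /andP[h _]; lra.
have wan : 0 < w a ^+ n by rewrite exprn_gt0.
rewrite mulrC -ler_pdivlMr //.
have -> : m * mu ^+ n * mu ^+ n / w a ^+ n = (m * mu ^+ n / w a ^+ n) * mu ^+ n.
  by rewrite mulrAC.
apply: (bernstein_walsh (E := K `&` cball a (r / 2)) n0 pn _ (ltW mu1)).
- by rewrite divr_gt0 // mulr_gt0 // exprn_gt0.
- move=> z [Kz az]; rewrite ler_pdivlMr // mulrC.
  apply: (@le_trans _ _ ((mu * w z) ^+ n * normc (peval p z))).
    rewrite ler_wpM2r ?normc_ge0 // lerXn2r ?nnegrE ?mulr_ge0 ?w0 ?(ltW wa) ?(ltW mu0) //.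
    by rewrite -ler_pdivrMl // mulrC wlow.
  by rewrite exprMn -mulrA mulrC ler_wpM2r ?exprn_ge0 ?(ltW mu0) // hp.
- apply: le_trans (ltW hV); apply: ereal_sup_ubound; exists x => //.
  by apply: hr'; apply: polydisc_le ax; rewrite ge_min lexx orbT.
Qed.

Lemma size_line_poly p n a b : deg_le p n -> (size (line_poly p a b) <= n.+1)%N.
Proof.
move=> pn; apply: leq_trans (size_sum _ _ _) _; apply/bigmax_leqP_seq => m mp _.
rewrite mul_polyC; apply: leq_trans (size_scale_leq _ _) _.
apply: leq_trans (size_prod_leq _ _) _.
rewrite card_ord leq_subLR; apply: (@leq_trans (\sum_(i < d) (m i).+1).+1).
  rewrite ltnS; apply: leq_sum => i _.
  apply: leq_trans (size_poly_exp_leq _ _) _; rewrite ltnS.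
  rewrite -[leqRHS]mul1n leq_mul2r; apply/orP; right.
  have : (size ((a ord0 i)%:P + b ord0 i *: 'X)%R <= 2)%N.
    apply: leq_trans (size_polyD _ _) _; rewrite geq_max.
    rewrite (leq_trans (size_polyC_leq1 _)) //.
    by rewrite (leq_trans (size_scale_leq _ _)) // size_polyX.
  by case: (size _) => [|[|]].
rewrite (eq_bigr (fun i => (1 + m i)%N)) // big_split /= sum1_card card_ord.
by rewrite addnS ltnS leq_add2l -mdegE pn.
Qed.

(** On the line from [a] to [x], Cauchy's inequality on the circle of radius [rho] bounds the
    [n + 1] coefficients, and [n + 1 <= 2 ^ n]. Halving [s / T] keeps that circle inside the open
    polydisc. *)
Lemma polydisc_growth p n a (s T M : R) x : 0 < s -> s <= T -> deg_le p n ->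
  (forall y, polydisc a s y -> normc (peval p y) <= M) ->
  polydisc a T x -> normc (peval p x) <= M * (4 * T / s) ^+ n.
Proof.
move=> s0 sT pn hM ax; have T0 : 0 < T by apply: lt_le_trans sT.
pose q := line_poly p a (x - a); pose rho := s / T / 2.
have rho0 : 0 < rho by rewrite !divr_gt0.
have qx : q.[1] = peval p x by rewrite horner_line_poly scale1r subrKC.
have coef k : normc q`_k * rho ^+ k <= M.
  apply: cauchy_coef => [|t _]; first exact: ltW.
  rewrite horner_line_poly; apply: hM => i; rewrite !mxE [X in normc X]addrC addKr.
  rewrite !Normc.normcM normc_expi mulr1 normc_real gtr0_norm //.
  have := ax i => h; apply: (@le_lt_trans _ _ (rho * T)).
    by rewrite ler_wpM2l // ltW.
  by rewrite /rho mulrAC divfK ?gt_eqF // ltr_pdivrMr // ltr_pMr // ltr1n.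
have M0 : 0 <= M by apply: le_trans (coef 0%N); rewrite expr0 mulr1 normc_ge0.
rewrite -qx horner_coef; apply: le_trans (le_normc_sum _ _ _) _.
apply: (@le_trans _ _ (\sum_(k < n.+1) M * rho^-1 ^+ n)).
  rewrite (@big_ord_widen _ _ _ _ n.+1 (fun k => normc (q`_k * 1 ^+ k)));
    last exact: size_line_poly.
  rewrite big_mkcond; apply: ler_sum => k _; case: ifP => _; last first.
    by rewrite mulr_ge0 // exprn_ge0 // invr_ge0 ltW.
  rewrite expr1n mulr1; apply: (@le_trans _ _ (M * rho^-1 ^+ k)).
    by rewrite exprVn ler_pdivlMr ?exprn_gt0.
  rewrite ler_wpM2l // ler_weXn2l //; last by rewrite -ltnS ltn_ord.
  rewrite invf_ge1 // /rho ler_pdivrMr // ler_pdivrMr //; lra.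
rewrite sumr_const card_ord -mulrnAr ler_wpM2l //.
have -> : 4 * T / s = 2 * rho^-1.
  by rewrite /rho; field; rewrite !gt_eqF.
rewrite exprMn -mulr_natl ler_wpM2r ?exprn_ge0 ?invr_ge0 ?(ltW rho0) //.
by rewrite -natrX ler_nat ltn_expl.
Qed.

(** A single point [a] of positive weight gives a bound near [a], by the local estimate with
    [mu = 2]; polynomial growth carries it to the whole unit neighbourhood of [K]. *)
Lemma global_bound : compact K -> (exists2 a, K a & 0 < w a) ->
  exists2 C : R, 1 <= C & forall y x n p m, K y -> polydisc y 1 x -> (0 < n)%N ->
    deg_le p n -> 0 < m -> weighted_le K w n p m -> normc (peval p x) <= m * C ^+ n.
Proof.
move=> cK [a Ka wa]; have [r r0 hr] := local_estimate Ka wa (ltr1n R 2).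
have [B B1 hB] := compact_coord_bounded cK.
pose s := Num.min 1 r; have s0 : 0 < s by rewrite lt_min ltr01.
(* Points within 1 of [K] are within [2 * B + 1] of [a] in each coordinate. *)
pose T := 2 * B + 2.
have sT : s <= T by rewrite /s ge_min /T; apply/orP; left; lra.
pose C := 4 / w a * (4 * T / s).
have T0 : 0 < T by rewrite /T; lra.
have C0 : 0 < C by rewrite /C mulr_gt0 // divr_gt0 // mulr_gt0.
exists (Num.max 1 C) => [|y x n p m Ky yx n0 pn m0 hp]; first by rewrite le_max lexx.
apply: (@le_trans _ _ (m * C ^+ n)); last first.
  by rewrite ler_pM2l // lerXn2r ?nnegrE ?le_max ?ler01 ?lexx ?orbT // ltW.
rewrite /C exprMn mulrA.
apply: (@polydisc_growth p n a s T _ x s0 sT pn) => [z az|].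
  have /hr[_ /(_ n p m n0 pn m0 hp)] : polydisc a r z.
    by apply: polydisc_le az; rewrite ge_min lexx orbT.
  rewrite exprMn exprVn [m * (_ / _)]mulrA ler_pdivlMr ?exprn_gt0 //.
  by rewrite mulrC -mulrA -exprMn -natrM.
move=> i; rewrite -(subrKA (y ord0 i)); apply: le_lt_trans (le_normcD _ _) _.
have := yx i; have := le_normcD (y ord0 i) (- a ord0 i); rewrite normcN.
have := hB y Ky i; have := hB a Ka i; rewrite /T; lra.
Qed.

(** Where [w z >= 1 / C], the local estimate costs [mu ^ (2 n)] and comparing [w y] with [w z] at
    most [mu ^ n], whence [mu ^ 3 <= lam]; the [k] missing weight factors cost [C ^ k]. *)
Lemma local_bound_weighted : compact K -> (exists2 a, K a & 0 < w a) -> local_bound K w.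
Proof.
move=> cK aw lam lam1; have [C C1 hC] := global_bound cK aw.
have C0 : 0 < C by apply: lt_le_trans C1.
have [mu mu1 mulam] : exists2 mu : R, 1 < mu & mu ^+ 3 <= lam.
  pose e := Num.min 1 (lam - 1).
  have e0 : 0 < e by rewrite lt_min ltr01 subr_gt0.
  have e1 : e <= 1 by rewrite ge_min lexx.
  have el : e <= lam - 1 by rewrite ge_min lexx orbT.
  (* For [0 < e <= 1] the cube of [1 + e / 7] is at most [1 + e], hence at most [lam]. *)
  exists (1 + e / 7); first by rewrite ltrDl divr_gt0.
  have -> : (1 + e / 7) ^+ 3 = 1 + (3 * e / 7 + 3 * e ^+ 2 / 49 + e ^+ 3 / 343) by field.
  have : e ^+ 2 <= e by rewrite expr2 ler_piMl // ltW.
  have : e ^+ 3 <= e by rewrite exprS ler_piMr // ?exprn_ile1 // ltW.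
  lra.
have mu0 : 0 < mu by apply: lt_trans mu1.
have [z Kz|dl dl0 h] := compact_uniform (Q := fun dl y => forall x n k p m,
    polydisc y dl x -> (0 < n)%N -> (k <= n)%N -> deg_le p n -> 0 < m ->
    weighted_le K w n p m ->
    w y ^+ (n - k) * normc (peval p x) <= m * lam ^+ n * C ^+ k) cK; last first.
  by exists dl, C; split => // y x n k p m Ky yx; exact: h.
(* Where w < 1 / C the crude bound m * C ^ n costs only C ^ k. *)
have [zC|Cz] := ltP (w z) C^-1.
  have wz0 : 0 < C^-1 - w z by rewrite subr_gt0.
  have [r r0 hr] := within_continuous_near wc Kz wz0.
  exists (Num.min 1 r) => [|y dl Ky zy]; first by rewrite lt_min ltr01.
  rewrite lt_min => /andP[dl0 /andP[dl1 _]] x n k p m yx n0 kn pn m0 hp.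
  have wy : w y <= C^-1.
    have /(hr y Ky) : polydisc z r y by apply: polydisc_le zy; rewrite ge_min lexx orbT.
    by rewrite ltr_norml => /andP[h _]; lra.
  have px := hC y x n p m Ky (polydisc_le (ltW dl1) yx) n0 pn m0 hp.
  apply: (@le_trans _ _ (C^-1 ^+ (n - k) * (m * C ^+ n))).
    rewrite ler_pM ?exprn_ge0 ?normc_ge0 ?w0 //.
    by rewrite lerXn2r ?nnegrE ?w0 ?invr_ge0 ?(ltW C0).
  rewrite mulrCA exprVn -{2}(subnK kn) exprD mulKf ?expf_neq0 ?gt_eqF // -mulrA.
  by rewrite ler_wpM2l ?(ltW m0) // ler_peMl ?exprn_ge0 ?exprn_ege1 ?(ltW C0) ?(ltW lam1).
have wz : 0 < w z by apply: lt_le_trans Cz; rewrite invr_gt0.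
have [r r0 hr] := local_estimate Kz wz mu1.
exists (r / 2) => [|y dl Ky zy /andP[dl0 dlr] x n k p m yx n0 kn pn m0 hp].
  by rewrite divr_gt0.
have zx : polydisc z r x by apply: polydisc_le (polydisc_trans yx zy); lra.
have zy' : polydisc z r y by apply: polydisc_le zy; lra.
have [_ /(_ n p m n0 pn m0 hp) px] := hr x zx.
have [/(_ Ky) wy _] := hr y zy'.
have wn0 : 0 < w z ^+ n by rewrite exprn_gt0.
rewrite -(ler_pM2l wn0) mulrCA.
apply: (@le_trans _ _ ((mu * w z) ^+ (n - k) * (m * mu ^+ n * mu ^+ n))).
  apply: ler_pM px; first by rewrite exprn_ge0 ?w0.
    by rewrite mulr_ge0 ?exprn_ge0 ?normc_ge0 ?(ltW wz).
  by rewrite lerXn2r ?nnegrE ?w0 ?mulr_ge0 ?(ltW wz) ?(ltW mu0).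
have -> : (mu * w z) ^+ (n - k) * (m * mu ^+ n * mu ^+ n) =
    m * w z ^+ (n - k) * (mu ^+ (n - k) * mu ^+ n * mu ^+ n) by rewrite exprMn; ring.
have -> : w z ^+ n * (m * lam ^+ n * C ^+ k) =
    m * w z ^+ (n - k) * (lam ^+ n * (w z * C) ^+ k).
  by rewrite -{1}(subnK kn) exprD exprMn; ring.
rewrite ler_wpM2l ?mulr_ge0 ?exprn_ge0 ?(ltW wz) ?(ltW m0) //.
(* Here [w z * C >= 1], so its [k]-th power only helps. *)
apply: (@le_trans _ _ (lam ^+ n)); last first.
  rewrite ler_peMr ?exprn_ge0 ?(le_trans ler01 (ltW lam1)) // exprn_ege1 //.
  by rewrite -ler_pdivrMr // div1r.
apply: (@le_trans _ _ ((mu ^+ 3) ^+ n)); last first.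
  by rewrite lerXn2r ?nnegrE ?exprn_ge0 ?(ltW mu0) // (le_trans ler01 (ltW lam1)).
have -> : (mu ^+ 3) ^+ n = mu ^+ n * mu ^+ n * mu ^+ n.
  by rewrite -exprM mulnC exprM !exprS expr0 mulr1 mulrA.
by rewrite !ler_wpM2r ?exprn_ge0 ?(ltW mu0) // ler_weXn2l ?(ltW mu1) // leq_subr.
Qed.

End weighted.
End local_bounds.

(** * Chebyshev constants *)

(** Infima need not be attained; this allows products of infima to be handled through
    near-minimisers. *)
Lemma ler_mul_gt (R : realFieldType) (t x y : R) : 0 <= x -> 0 <= y ->
  (forall m m', x < m -> y < m' -> t <= m * m') -> t <= x * y.
Proof.
move=> x0 y0 h; rewrite leNgt; apply/negP => xyt.
pose e := Num.min 1 ((t - x * y) / (x + y + 2)).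
have s0 : 0 < x + y + 2 by lra.
have e0 : 0 < e by rewrite lt_min ltr01 divr_gt0 // subr_gt0.
have e1 : e <= 1 by rewrite ge_min lexx.
(* Then [(x + e) * (y + e) <= x * y + e * (x + y + 1) < t]. *)
have es : e * (x + y + 2) <= t - x * y.
  by rewrite -ler_pdivlMr // ge_min lexx orbT.
have /h : x < x + e by rewrite ltrDl.
move=> /(_ (y + e)); rewrite ltrDl => /(_ e0).
have : e * e <= e by rewrite ler_piMl // ltW.
nra.
Qed.

Section chebyshev.
Context (R : realType) (d : nat) (K : set (cspace R d)) (w : cspace R d -> R).
Implicit Types (p q : mpoly d R[i]) (a b c : multinom d).
Local Notation normc := Normc.normc.
Hypothesis w0 : forall z, K z -> 0 <= w z.
Variables (B W : R).
Hypotheses (B1 : 1 <= B) (hB : forall z, K z -> forall i, normc (z ord0 i) <= B).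
Hypotheses (W1 : 1 <= W) (hW : forall z, K z -> w z <= W).

Definition wsup_norm n p : R :=
  sup_norm K (fun z => (real_complex R (w z)) ^+ n * peval p z).

Definition cheb_inf a : R := inf [set wsup_norm (mdeg a) p | p in monic_class a].

Lemma normc_weighted n p z : K z ->
  normc ((real_complex R (w z)) ^+ n * peval p z) = w z ^+ n * normc (peval p z).
Proof. by move=> Kz; rewrite Normc.normcM normcX normc_real ger0_norm // w0. Qed.

Lemma deg_le_exists p : exists n, deg_le p n.
Proof.
exists (\max_(m <- msupp p) mdeg m) => c cp.
by rewrite (leq_bigmax_seq _ cp).
Qed.

(** The bounds [B] and [W] make the set of values bounded, so that [sup] is a genuine upper
    bound. *)
Lemma wsup_norm_ge n p : weighted_le K w n p (wsup_norm n p).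
Proof.
move=> z Kz; rewrite -normc_weighted //; apply: ub_le_sup; last by exists z.
have [k pk] := deg_le_exists p.
exists (W ^+ n * (coef_norm p * B ^+ k)) => _ [y Ky <-]; rewrite normc_weighted //.
apply: ler_pM; rewrite ?exprn_ge0 ?w0 ?normc_ge0 //.
  by rewrite lerXn2r ?nnegrE ?w0 ?hW // (le_trans ler01).
by apply: normc_peval_le => //; exact: hB.
Qed.

Lemma wsup_norm_le n p M : 0 <= M -> weighted_le K w n p M -> wsup_norm n p <= M.
Proof.
move=> M0 hM; rewrite /wsup_norm /sup_norm.
have [[z Kz]|K0] := pselect (K !=set0).
  apply: ge_sup => [|_ [y Ky <-]]; last by rewrite normc_weighted // hM.
  by eexists; exists z => //.
(* For empty [K] the norm is the default value 0 of [sup], covered by [0 <= M]. *)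
rewrite [X in sup X](_ : _ = set0) ?sup0 //.
by rewrite -subset0 => v [y Ky _]; apply: K0; exists y.
Qed.

Lemma wsup_norm_ge0 n p : 0 <= wsup_norm n p.
Proof.
have [[z Kz]|K0] := pselect (K !=set0).
  apply: le_trans (wsup_norm_ge n p Kz).
  by rewrite mulr_ge0 ?exprn_ge0 ?w0 ?normc_ge0.
rewrite /wsup_norm /sup_norm [X in sup X](_ : _ = set0) ?sup0 //.
by rewrite -subset0 => v [y Ky _]; apply: K0; exists y.
Qed.

Lemma monic_mpolyX a : monic_class a (mpolyX R[i] a).
Proof.
split; first by rewrite mcoeffX eqxx.
by move=> b; rewrite msuppX inE => /eqP; left.
Qed.

Lemma monic_deg_le a p : monic_class a p -> deg_le p (mdeg a).
Proof. by move=> [_ h] c /h; exact: glex_le_mdeg. Qed.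

Lemma cheb_inf_has_inf a : has_inf [set wsup_norm (mdeg a) p | p in monic_class a].
Proof.
split; first by eexists; exists (mpolyX R[i] a) => //; exact: monic_mpolyX.
by exists 0 => _ [p _ <-]; exact: wsup_norm_ge0.
Qed.

Lemma cheb_inf_ge0 a : 0 <= cheb_inf a.
Proof.
apply: lb_le_inf; first by case: (cheb_inf_has_inf a).
by move=> _ [p _ <-]; exact: wsup_norm_ge0.
Qed.

Lemma cheb_inf_le a p M : monic_class a p -> 0 <= M ->
  weighted_le K w (mdeg a) p M -> cheb_inf a <= M.
Proof.
move=> ap M0 hM; apply: le_trans (wsup_norm_le M0 hM).
by apply: ge_inf; [case: (cheb_inf_has_inf a)|exists p].
Qed.

Lemma cheb_inf_lt a M : cheb_inf a < M ->
  exists2 p, monic_class a p & weighted_le K w (mdeg a) p M.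
Proof.
move=> /(inf_lt (cheb_inf_has_inf a).1)[_ [p ap <-] pM]; exists p => // z Kz.
exact: le_trans (wsup_norm_ge _ _ Kz) (ltW pM).
Qed.

(** Only the pair of leading exponents contributes to the coefficient at [a + b]: any other pair has
    a strictly smaller sum. *)
Lemma monic_mul a b p q : monic_class a p -> monic_class b q ->
  monic_class (mnm_add a b) (p * q).
Proof.
move=> [pa hp] [qb hq]; split; last first.
  move=> c /msuppM_le /allpairsP[[m1 m2] /= [/hp h1 /hq h2 ->]].
  exact: glex_lt_add.
rewrite mcoeffM.
have da : (mdeg a < (mdeg (mnm_add a b)).+1)%N by rewrite ltnS mdegD leq_addr.
have db : (mdeg b < (mdeg (mnm_add a b)).+1)%N by rewrite ltnS mdegD leq_addl.
rewrite (bigD1 (BMultinom da, BMultinom db)) //= pa qb mulr1 big1 ?addr0 //.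
move=> [[m1 l1] [m2 l2]] /= /andP[/eqP e ne].
apply/eqP; apply: contraT; rewrite mulf_eq0 negb_or -!mcoeff_msupp => /andP[].
move=> /hp h1 /hq h2.
have [e1|n1] := eqVneq m1 a.
  move: e; rewrite e1 => /addmI e2; move: ne.
  by rewrite -pair_eqE /pair_eq /= -!val_eqE /= e1 -e2 !eqxx.
case: h1 => [/eqP|h1]; first by rewrite (negbTE n1).
by have := glex_lt_addl h1 h2; rewrite e => /glex_lt_irr.
Qed.

Lemma cheb_inf_mul a b : cheb_inf (mnm_add a b) <= cheb_inf a * cheb_inf b.
Proof.
apply: ler_mul_gt; rewrite ?cheb_inf_ge0 // => M N hM hN.
have [p ap pM] := cheb_inf_lt hM; have [q bq qN] := cheb_inf_lt hN.
have M0 : 0 <= M by apply: le_trans (ltW hM); exact: cheb_inf_ge0.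
have N0 : 0 <= N by apply: le_trans (ltW hN); exact: cheb_inf_ge0.
apply: (cheb_inf_le (monic_mul ap bq)); first exact: mulr_ge0.
move=> z Kz; rewrite /peval mevalM Normc.normcM mdegD exprD mulrACA.
apply: ler_pM; rewrite ?mulr_ge0 ?exprn_ge0 ?w0 ?normc_ge0 //; [exact: pM|exact: qN].
Qed.

Lemma cheb_inf_expR a : cheb_inf a <= expR (ln (W * B) * (mdeg a)%:R).
Proof.
have WB0 : 0 < W * B by rewrite mulr_gt0 // (lt_le_trans ltr01).
rewrite expRM_natr lnK ?posrE //.
apply: (cheb_inf_le (monic_mpolyX a)); first by rewrite exprn_ge0 ?ltW.
move=> z Kz; rewrite exprMn; apply: ler_pM; rewrite ?exprn_ge0 ?w0 ?normc_ge0 //.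
  by rewrite lerXn2r ?nnegrE ?w0 ?hW // (le_trans ler01).
have := normc_peval_le (monic_deg_le (monic_mpolyX a)) B1 (hB Kz).
by rewrite /coef_norm msuppX big_seq1 mcoeffX eqxx Normc.normc1 mul1r.
Qed.

(** The coefficient of [z ^ b] in [D ^ c] applied to [z ^ (b + c)]. *)
Definition falling b c : nat := \prod_(i < d) ((mnm_add c b) i) ^_ (c i).

(** Making the derivative monic thus absorbs the factorials of Cauchy's inequality. *)
Lemma falling_ge b c : (\prod_(i < d) (c i)`! <= falling b c)%N.
Proof.
apply: leq_prod => i _; rewrite -bin_ffact leq_pmull // bin_gt0.
by rewrite mnmDE leq_addr.
Qed.

Lemma falling_gt0 b c : (0 < falling b c)%N.
Proof.
apply: leq_trans (falling_ge b c).
by rewrite prodn_gt0 // => i; rewrite fact_gt0.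
Qed.

Lemma monic_mderivm b c p : monic_class (mnm_add b c) p ->
  monic_class b ((falling b c)%:R^-1 *: mderivm c p).
Proof.
move=> [pa hp]; split.
  rewrite mcoeffZ mcoeff_mderivm (_ : mcoeff _ p = 1); last by rewrite addmC.
  by apply: mulVf; rewrite pnatr_eq0 -lt0n falling_gt0.
move=> x /msuppZ_le; rewrite mcoeff_msupp mcoeff_mderivm => h.
have : mnm_add c x \in msupp p.
  by rewrite mcoeff_msupp; apply: contra h => /eqP ->; rewrite mul0rn.
move=> /hp; rewrite (addmC b c) => -[/addmI|/glex_lt_add2l]; [by left|by right].
Qed.

(** The normalised derivative [D ^ c] of a near-minimiser for [b + c] competes for [b]; Cauchy's
    inequality and the local bound control its weighted norm. *)
Lemma cheb_inf_shift : local_bound K w -> forall e : R, 0 < e ->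
  exists2 g : R, 0 <= g & forall b c, (0 < mdeg (mnm_add b c))%N ->
  cheb_inf b <= expR (e * (mdeg (mnm_add b c))%:R + g * (mdeg c)%:R) *
                cheb_inf (mnm_add b c).
Proof.
move=> lb e e0; have lam1 : 1 < expR e by rewrite expR_gt1.
have [dl [D [dl0 D1 h]]] := lb _ lam1.
(* Cauchy's inequality uses a closed polydisc, which must fit in the open one of radius [dl]. *)
pose r := dl / 2; have r0 : 0 < r by rewrite divr_gt0.
pose G := Num.max 1 (D / r); have G0 : 0 < G by rewrite lt_max ltr01.
exists (ln G) => [|b c bc0]; first by rewrite ln_ge0 // le_max lexx.
rewrite expRD !expRM_natr lnK ?posrE //.
set n := mdeg (mnm_add b c); set k := mdeg c.
apply: ler_mul_gt => [||M' M hM' hM].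
- by rewrite mulr_ge0 ?exprn_ge0 ?expR_ge0 ?ltW.
- exact: cheb_inf_ge0.
have M0 : 0 < M by apply: le_lt_trans hM; exact: cheb_inf_ge0.
have [p pbc pM] := cheb_inf_lt hM.
apply: (@le_trans _ _ (expR e ^+ n * G ^+ k * M)); last first.
  by rewrite ler_pM2r // ltW.
apply: (cheb_inf_le (monic_mderivm pbc)).
  by rewrite !mulr_ge0 ?exprn_ge0 ?expR_ge0 ?(ltW G0) ?(ltW M0).
move=> y Ky; have kn : (k <= n)%N by rewrite /n mdegD leq_addl.
have nk : mdeg b = (n - k)%N by rewrite /n mdegD addnK.
have bound (x : cspace R d) : (forall i, normc (x ord0 i - y ord0 i) <= r) ->
    w y ^+ mdeg b * normc (peval p x) <= M * expR e ^+ n * D ^+ k.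
  move=> yx; rewrite nk; apply: h => //; last exact: monic_deg_le pbc.
  by move=> i; apply: le_lt_trans (yx i) _; rewrite ltr_pdivrMr // ltr_pMr // ltr1n.
(* Where the weight power vanishes the bound is trivial; elsewhere it can be divided out to bound
   [p] itself near [y]. *)
have [/eqP wy|wy] := boolP (w y ^+ mdeg b == 0).
  by rewrite wy mul0r !mulr_ge0 ?exprn_ge0 ?expR_ge0 ?(ltW G0) ?(ltW M0).
have {}wy : 0 < w y ^+ mdeg b by rewrite lt_def wy exprn_ge0 // w0.
pose T := M * expR e ^+ n * D ^+ k / w y ^+ mdeg b.
have cau : normc (peval (mderivm c p) y) * r ^+ k <= (\prod_i (c i)`!)%:R * T.
  apply: cauchy_mderivm => [|x yx]; first exact: ltW.
  by rewrite /T ler_pdivlMr // mulrC bound.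
have F0 : 0 < (falling b c)%:R :> R by rewrite ltr0n falling_gt0.
have T0 : 0 <= T.
  rewrite /T divr_ge0 ?(ltW wy) // !mulr_ge0 ?exprn_ge0 ?expR_ge0 ?(ltW M0) //.
  exact: le_trans ler01 D1.
have cau' : normc (peval (mderivm c p) y) <= (falling b c)%:R * (T / r ^+ k).
  rewrite mulrA ler_pdivlMr ?exprn_gt0 //; apply: le_trans cau _.
  by rewrite ler_wpM2r // ler_nat falling_ge.
rewrite {1}/peval mevalZ Normc.normcM Normc.normcV normc_nat.
apply: (@le_trans _ _ (w y ^+ mdeg b * (T / r ^+ k))).
  by rewrite ler_pM2l // ler_pdivrMl.
have -> : w y ^+ mdeg b * (T / r ^+ k) = expR e ^+ n * (D / r) ^+ k * M.
  rewrite /T (expr_div_n D r); move: (w y ^+ mdeg b) wy => u u0.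
  have : r ^+ k != 0 by rewrite expf_neq0 // gt_eqF.
  move: (r ^+ k) => v v0; move: (D ^+ k) (expR e ^+ n) => D' E'.
  by field; rewrite v0 gt_eqF.
rewrite ler_pM2r // ler_pM2l ?exprn_gt0 ?expR_gt0 //.
have DG : D / r <= G by rewrite /G le_max lexx orbT.
have D0 : 0 <= D / r by rewrite divr_ge0 ?(ltW r0) // (le_trans ler01 D1).
by rewrite lerXn2r ?nnegrE // ltW.
Qed.

(** [wcheb_const K w] is by conversion the root rate of [cheb_inf], so the limit theorem for
    submultiplicative functions applies. *)
Lemma cheb_inf_limit theta : simplex R d theta -> local_bound K w ->
  is_limit_direction (wcheb_const K w) theta (dir_wcheb_const K w theta).
Proof.
move=> htheta lb.
exact: (root_rate_limit cheb_inf_ge0 cheb_inf_mul cheb_inf_expR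
  (cheb_inf_shift lb) htheta).
Qed.

End chebyshev.

Lemma local_bound_limit (R : realType) (d : nat) (K : set (cspace R d))
    (w : cspace R d -> R) theta :
  simplex R d theta -> compact K -> {within K, continuous w} ->
  (forall z, K z -> 0 <= w z) -> local_bound K w ->
  is_limit_direction (wcheb_const K w) theta (dir_wcheb_const K w theta).
Proof.
move=> htheta cK wc w0 lb.
have [B B1 hB] := compact_coord_bounded cK.
have [W W1 hW] := compact_weight_bounded cK wc.
exact: (cheb_inf_limit w0 B1 hB W1 hW).
Qed.

Lemma wcheb_const1 (R : realType) (d : nat) (K : set (cspace R d)) :
  wcheb_const K (fun=> 1) = cheb_const K.
Proof.
apply/funext => a; rewrite /wcheb_const /cheb_const; congr (inf _ `^ _).
apply: eq_imagel => p _; congr (sup_norm K _); apply/funext => z.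
by rewrite [real_complex R 1](_ : _ = 1) // expr1n mul1r.
Qed.

(** Otherwise the set of positive weight would be empty, and any plurisubharmonic function shows
    that the empty set is pluripolar. *)
Lemma admissible_weight_pos (R : realType) (d : nat) (K : set (cspace R d)) w :
  admissible_weight K w -> exists2 a, K a & 0 < w a.
Proof.
move=> [_ npp]; apply: contrapT => h; apply: npp.
exists (log_poly 0 1); first exact: plurisubharmonic_log_poly.
by move=> z [Kz wz]; case: h; exists z.
Qed.

Theorem theorem1p1 (R : realType) (d : nat) (theta : 'rV[R]_d)
    (htheta : (simplex R d `\` simplex0 R d) theta) :
  (forall K : set (cspace R d), compact K -> regular K ->
     is_limit_direction (cheb_const K) theta (dir_cheb_const K theta)) /\
  (forall (K : set (cspace R d)) (w : cspace R d -> R),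
     compact K -> locally_regular K ->
     {within K, continuous w} -> admissible_weight K w ->
     is_limit_direction (wcheb_const K w) theta (dir_wcheb_const K w theta)).
Proof.
have [htheta' _] := htheta; split => [K cK rK|K w cK lK wc aw].
  (* The unweighted constants are those of the constant weight 1. *)
  have := local_bound_limit htheta' cK (w := fun=> 1).
  rewrite /dir_wcheb_const wcheb_const1; apply.
  - by apply: continuous_subspaceT; exact: cst_continuous.
  - by move=> z _; exact: ler01.
  - exact: local_bound_regular.
have [w0 _] := aw.
apply: local_bound_limit => //; apply: local_bound_weighted => //.
exact: admissible_weight_pos aw.
Qed.
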